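(* Let $(M^m,g)$ be a Riemannian manifold, $(N^{2n},J,h)$ a Kähler manifold of real dimension $2n$ with $n\geq 2$, and $V$ a smooth vector field on $M$. Let $\varphi:M\to N$ be a pseudo-horizontally homothetic (PHH) submersion. Then $\varphi$ is $V$-harmonic if and only if $\varphi$ has $V$-minimal fibres (i.e. every fibre of $\varphi$ is a $V$-minimal submanifold of $M$).
   Context: $V$-harmonic maps: for a smooth map $\varphi:(M,g)\to(N,h)$, the tension field is $\tau(\varphi)=\mathrm{trace}_g\nabla d\varphi\in\Gamma(\varphi^{-1}TN)$, and the $V$-tension field is $\tau_V(\varphi)=\tau(\varphi)+d\varphi(V)$. The map $\varphi$ is $V$-harmonic if $\tau_V(\varphi)=0$. PHWC and PHH maps: for $x\in M$, let $d\varphi_x^*:T_{\varphi(x)}N\to T_xM$ denote the adjoint of $d\varphi_x$ with respect to $g$ and $h$. For a local section $Y$ of $\varphi^{-1}TN$ (in particular for a vector field $Y$ on $N$, pulled back by $\varphi$), $d\varphi^*(Y)$ is a local horizontal vector field on $M$, horizontal meaning orthogonal to $\ker d\varphi$. The map $\varphi$ is pseudo-horizontally weakly conformal (PHWC) if $[d\varphi_x\circ d\varphi_x^*,J_{\varphi(x)}]=0$ for every $x\in M$. A PHWC map $\varphi$ is pseudo-horizontally homothetic (PHH) if $$d\varphi(\nabla^M_X d\varphi^*(JY))=J\,d\varphi(\nabla^M_X d\varphi^*(Y))$$ for every horizontal vector field $X$ on $M$ and every (local) vector field $Y$ on $N$; this condition is then also valid for all local sections $Y$ of $\varphi^{-1}TN$.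 $V$-minimality: let $K$ be a submanifold of $(M,g)$. The second fundamental form $A:TK\times TK\to TK^\perp$ is defined by $\nabla^M_XY=\nabla^K_XY+A(X,Y)$ for $X,Y\in\Gamma(TK)$, where $\nabla^M,\nabla^K$ are the Levi-Civita connections. Its trace is not normalized: $\mathrm{trace}(A)=\sum_jA(e_j,e_j)$ over a local orthonormal frame $\{e_j\}$ of $TK$. The submanifold $K$ is $V$-minimal if $\mathrm{trace}(A)-V$ (with $V$ restricted to $K$) is tangent to $K$ at every point of $K$, equivalently $\mathrm{trace}(A)-V^\perp=0$, where $V^\perp$ is the component of $V|_K$ normal to $K$. *)

(* Defs.v *)
From HB Require Import structures.
From mathcomp Require Import all_boot all_order all_algebra.
From mathcomp Require Import all_classical all_reals all_analysis.
Set Implicit Arguments.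
Unset Strict Implicit.
Unset Printing Implicit Defensive.
Import Order.TTheory GRing.Theory Num.Theory.
Import numFieldNormedType.Exports.
Local Open Scope classical_set_scope.
Local Open Scope ring_scope.

(* Conventions.  Tangent vectors are given by their components in a chart and
   are row vectors; linear maps act by right multiplication, so a differential
   is [v |-> v *m jacobian f z] and [A *m B] is "A, then B".  Tensor fields are
   families of component functions, one for each chart, related by the usual
   transformation rules; component functions are functions of the coordinates
   [z] of the point.  A pointwise notion on a manifold is stated in every chart
   around the point; each of them is invariant under change of chart. *)

Section LocalCalculus.
Context {R : realType}.

Definition ebase {m} (i : 'I_m) : 'rV[R]_m := delta_mx 0 i.

Fixpoint iter_partial {m} {W : normedModType R} (s : seq 'I_m)
    (f : 'rV[R]_m -> W) : 'rV[R]_m -> W :=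
  if s is i :: s' then fun z => 'D_(ebase i) (iter_partial s' f) z else f.

(* C^oo on U (meant for U open): the iterated partial derivatives of all orders
   exist and are differentiable, hence continuous. *)
Definition smooth_on {m} {W : normedModType R} (U : set 'rV[R]_m)
    (f : 'rV[R]_m -> W) : Prop :=
  forall (s : seq 'I_m) z, U z -> differentiable (iter_partial s f) z.

(* g(u, v) for the bilinear form of Gram matrix G *)
Definition inner {m} (G : 'M[R]_m) (u v : 'rV[R]_m) : R :=
  (u *m G *m v^T) 0 0.

(* Gamma(u, v)^k = Gamma^k_ij u^i v^j, where
   Gamma^k_ij = 1/2 g^kl (d_i g_jl + d_j g_il - d_l g_ij) *)
Definition christoffel {m} (G : 'rV[R]_m -> 'M[R]_m) (z u v : 'rV[R]_m) :
    'rV[R]_m :=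
  \row_k \sum_i \sum_j \sum_l
    2^-1 * invmx (G z) k l *
    ('D_(ebase i) (fun y => G y j l) z + 'D_(ebase j) (fun y => G y i l) z
     - 'D_(ebase l) (fun y => G y i j) z) * u 0 i * v 0 j.

(* Levi-Civita derivative of the field Y in the direction of the vector u *)
Definition nabla {m} (G : 'rV[R]_m -> 'M[R]_m) (u : 'rV[R]_m)
    (Y : 'rV[R]_m -> 'rV[R]_m) (z : 'rV[R]_m) : 'rV[R]_m :=
  'D_u Y z + christoffel G z u (Y z).

Section Maps.
Context {m k : nat} (G : 'rV[R]_m -> 'M[R]_m) (H : 'rV[R]_k -> 'M[R]_k)
  (f : 'rV[R]_m -> 'rV[R]_k).

(* connection of the pulled-back bundle, on a field W along f *)
Definition nabla_along (u : 'rV[R]_m) (W : 'rV[R]_m -> 'rV[R]_k)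
    (z : 'rV[R]_m) : 'rV[R]_k :=
  'D_u W z + christoffel H (f z) (u *m jacobian f z) (W z).

(* (nabla df)(X, Y) *)
Definition nabla_d (X Y : 'rV[R]_m -> 'rV[R]_m) (z : 'rV[R]_m) : 'rV[R]_k :=
  nabla_along (X z) (fun y => Y y *m jacobian f y) z
  - nabla G (X z) Y z *m jacobian f z.

Definition tension (z : 'rV[R]_m) : 'rV[R]_k :=
  \sum_i \sum_j invmx (G z) i j *: nabla_d (fun=> ebase i) (fun=> ebase j) z.

(* matrix of the adjoint of the differential, see adjointP *)
Definition adjoint (z : 'rV[R]_m) : 'M[R]_(k, m) :=
  H (f z) *m (jacobian f z)^T *m invmx (G z).

Lemma adjointP z (w : 'rV[R]_k) (u : 'rV[R]_m) : G z \in unitmx ->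
  inner (G z) (w *m adjoint z) u = inner (H (f z)) w (u *m jacobian f z).
Proof.
by move=> Gu; rewrite /inner /adjoint trmx_mul !mulmxA mulmxKV.
Qed.

Definition horizontal (z u : 'rV[R]_m) : Prop :=
  forall v : 'rV[R]_m, v *m jacobian f z = 0 -> inner (G z) u v = 0.

End Maps.
End LocalCalculus.

(* [param c] is the inverse of the chart [coord c : dom c -> 'rV[R]_m]; outside
   of its domain [coord c], and outside of [coord c @` dom c] [param c], is
   arbitrary. *)
Record manifold (R : realType) (m : nat) := Manifold {
  point_of :> topologicalType;
  chart : Type;
  dom : chart -> set point_of;
  coord : chart -> point_of -> 'rV[R]_m;
  param : chart -> 'rV[R]_m -> point_of;
  manifold_hausdorff : hausdorff_space point_of;
  manifold_second_countable : @second_countable point_of;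
  dom_open : forall c, open (dom c);
  dom_cover : forall p, exists c, dom c p;
  coord_open : forall c, open (coord c @` dom c);
  coordK : forall c p, dom c p -> param c (coord c p) = p;
  coord_continuous : forall c p, dom c p -> {for p, continuous (coord c)};
  param_continuous : forall c z, (coord c @` dom c) z ->
    {for z, continuous (param c)};
  transition_smooth : forall c d,
    smooth_on (coord c @` (dom c `&` dom d)) (coord d \o param c)
}.

Arguments chart {R m} M : rename.

Section Tensors.
Context {R : realType} {m : nat} (M : manifold R m).

Definition cimg (c : chart M) : set 'rV[R]_m := coord c @` dom c.

Definition overlap (c d : chart M) : set 'rV[R]_m :=
  coord c @` (dom c `&` dom d).

Definition transition (c d : chart M) : 'rV[R]_m -> 'rV[R]_m :=
  coord d \o param c.

Record riemannian_metric := RiemannianMetric {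
  gram : chart M -> 'rV[R]_m -> 'M[R]_m;
  gram_smooth : forall c, smooth_on (cimg c) (gram c);
  gram_sym : forall c z, cimg c z -> (gram c z)^T = gram c z;
  gram_pos : forall c z, cimg c z -> forall v, v != 0 -> 0 < inner (gram c z) v v;
  gram_change : forall c d z, overlap c d z ->
    gram c z = jacobian (transition c d) z *m gram d (transition c d z)
               *m (jacobian (transition c d) z)^T
}.

Record vector_field := VectorField {
  vcomp : chart M -> 'rV[R]_m -> 'rV[R]_m;
  vcomp_smooth : forall c, smooth_on (cimg c) (vcomp c);
  vcomp_change : forall c d z, overlap c d z ->
    vcomp d (transition c d z) = vcomp c z *m jacobian (transition c d) z
}.

Record almost_complex_structure := AlmostComplex {
  jmx : chart M -> 'rV[R]_m -> 'M[R]_m;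
  jmx_smooth : forall c, smooth_on (cimg c) (jmx c);
  jmx_sq : forall c z, cimg c z -> jmx c z *m jmx c z = - 1%:M;
  jmx_change : forall c d z, overlap c d z ->
    jmx c z *m jacobian (transition c d) z
    = jacobian (transition c d) z *m jmx d (transition c d z)
}.

Definition hermitian (h : riemannian_metric) (J : almost_complex_structure) :=
  forall c z, cimg c z -> forall u v : 'rV[R]_m,
    inner (gram h c z) (u *m jmx J c z) (v *m jmx J c z)
    = inner (gram h c z) u v.

(* nabla J = 0 *)
Definition parallel (h : riemannian_metric) (J : almost_complex_structure) :=
  forall c (U : set 'rV[R]_m) (X Y : 'rV[R]_m -> 'rV[R]_m),
    open U -> U `<=` cimg c -> smooth_on U X -> smooth_on U Y ->
    forall z, U z ->
      nabla (gram h c) (X z) (fun y => Y y *m jmx J c y) z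
      = nabla (gram h c) (X z) Y z *m jmx J c z.

Definition kahler (h : riemannian_metric) (J : almost_complex_structure) :=
  hermitian h J /\ parallel h J.

End Tensors.

Section SubmanifoldGeometry.
Context {R : realType} {m : nat} (M : manifold R m)
  (g : riemannian_metric M) (V : vector_field M) (K : set M).

(* v is the velocity at z of a curve in K *)
Definition tangent (c : chart M) (z v : 'rV[R]_m) : Prop :=
  exists gamma : R -> 'rV[R]_m,
    [/\ gamma 0 = z,
        \forall t \near (0 : R), cimg c (gamma t) /\ K (param c (gamma t))
      & is_derive (0 : R) (1 : R) gamma v].

Definition normal (c : chart M) (z v : 'rV[R]_m) : Prop :=
  forall u, tangent c z u -> inner (gram g c z) v u = 0.

(* A(u, w) = a: the normal part of nabla^M_u W is a, where the local field W is
   tangent to K along K and has the value w at z. *)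
Definition second_fundamental_form (c : chart M) (z u w a : 'rV[R]_m) : Prop :=
  exists (U : set 'rV[R]_m) (W : 'rV[R]_m -> 'rV[R]_m),
    [/\ [/\ open U, U z, U `<=` cimg c & smooth_on U W],
        forall y, U y -> K (param c y) -> tangent c y (W y),
        W z = w,
        normal c z a
      & tangent c z (nabla (gram g c) u W z - a)].

Definition orthonormal_basis (c : chart M) (z : 'rV[R]_m) (k : nat)
    (e : 'I_k -> 'rV[R]_m) : Prop :=
  [/\ forall j, tangent c z (e j),
      forall i j, inner (gram g c z) (e i) (e j) = (i == j)%:R
    & forall v, tangent c z v -> exists x : 'I_k -> R, v = \sum_j x j *: e j].

Definition V_minimal : Prop :=
  forall (c : chart M) z, cimg c z -> K (param c z) ->
  forall (k : nat) (e A : 'I_k -> 'rV[R]_m),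
    orthonormal_basis c z e ->
    (forall j, second_fundamental_form c z (e j) (e j) (A j)) ->
    tangent c z (\sum_j A j - vcomp V c z).

End SubmanifoldGeometry.

Section MapsBetweenManifolds.
Context {R : realType} {m k : nat} (M : manifold R m) (N : manifold R k)
  (g : riemannian_metric M) (h : riemannian_metric N)
  (J : almost_complex_structure N) (V : vector_field M) (phi : M -> N).

Definition local_dom (a : chart M) (b : chart N) : set 'rV[R]_m :=
  coord a @` (dom a `&` phi @^-1` dom b).

Definition local_map (a : chart M) (b : chart N) : 'rV[R]_m -> 'rV[R]_k :=
  coord b \o phi \o param a.

Definition smooth_map : Prop :=
  continuous phi /\
  forall a b, smooth_on (local_dom a b) (local_map a b).

Definition submersion : Prop :=
  smooth_map /\
  forall a b z, local_dom a b z ->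
    forall w : 'rV[R]_k, exists u, u *m jacobian (local_map a b) z = w.

Definition V_harmonic : Prop :=
  forall a b z, local_dom a b z ->
    tension (gram g a) (gram h b) (local_map a b) z
    + vcomp V a z *m jacobian (local_map a b) z = 0.

Definition PHWC : Prop :=
  forall a b z, local_dom a b z ->
    let f := local_map a b in
    let dfdf' := adjoint (gram g a) (gram h b) f z *m jacobian f z in
    dfdf' *m jmx J b (f z) = jmx J b (f z) *m dfdf'.

Definition PHH : Prop :=
  PHWC /\
  forall a b (U : set 'rV[R]_m) (X : 'rV[R]_m -> 'rV[R]_m)
         (W : set 'rV[R]_k) (Y : 'rV[R]_k -> 'rV[R]_k),
    let f := local_map a b in
    let pull (Z : 'rV[R]_k -> 'rV[R]_k) y :=
      Z (f y) *m adjoint (gram g a) (gram h b) f y in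
    open U -> U `<=` local_dom a b -> smooth_on U X ->
    (forall z, U z -> horizontal (gram g a) f z (X z)) ->
    open W -> W `<=` cimg b -> smooth_on W Y ->
    forall z, U z -> W (f z) ->
      nabla (gram g a) (X z) (pull (fun y => Y y *m jmx J b y)) z
        *m jacobian f z
      = nabla (gram g a) (X z) (pull Y) z *m jacobian f z *m jmx J b (f z).

End MapsBetweenManifolds.

(* Main.v *)
Require Import Defs.
From HB Require Import structures.
From mathcomp Require Import all_boot all_order all_algebra.
From mathcomp Require Import all_classical all_reals all_analysis.
From mathcomp Require Import ring lra.

(* Fix a point, with differential F and adjoint A, and let B be the second
   fundamental form of the map: B(X, Y) = nabla_X (dphi Y) - dphi (nabla_X Y),
   which is symmetric by Schwarz' theorem.  Splitting an orthonormal frame into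
   vertical and horizontal vectors splits the tension field, the trace of B.
   - Horizontal part: PHWC, nabla J = 0 and PHH give
     B(X, dphi^*(J Y)) = J B(X, dphi^* Y) for X horizontal, hence B changes sign
     under the isometry dphi^* Y |-> dphi^*(J Y) of the horizontal space applied
     to both arguments, and its horizontal trace vanishes.
   - Vertical part: for vertical e, B(e, e) = - dphi (A(e, e)) with A the second
     fundamental form of the fibre.
   So tau_V = dphi (V - trace A), which vanishes exactly when trace A - V is
   tangent to the fibre.  That every vector of ker dphi is tangent to the fibre
   in the sense of velocities of curves is an implicit function theorem. *)

Set Implicit Arguments.
Unset Strict Implicit.
Unset Printing Implicit Defensive.
Import Order.TTheory GRing.Theory Num.Theory.
Import numFieldNormedType.Exports.
Local Open Scope classical_set_scope.
Local Open Scope ring_scope.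

(** * Differential calculus for matrix-valued maps *)

Section MatrixCalculus.
Context {R : realType} {V : normedModType R}.

Lemma differentiable_mxP p q (M : V -> 'M[R]_(p, q)) t :
  differentiable M t <-> forall i j, differentiable (fun x => M x i j) t.
Proof.
split=> [dM i j|dM].
  exact: (differentiable_comp dM (differentiable_coord _ i j)).
have -> : M = \sum_(i < p) \sum_(j < q) (fun x => M x i j *: delta_mx i j).
  apply/funext => x; rewrite {1}[M x]matrix_sum_delta fct_sumE.
  by apply: eq_bigr => i _; rewrite fct_sumE.
apply: differentiable_sum => i; apply: differentiable_sum => j.
exact: differentiableZl.
Qed.

Lemma derive_mxE p q (M : V -> 'M[R]_(p, q)) t v i j : derivable M t v ->
  'D_v M t i j = 'D_v (fun x => M x i j) t.
Proof. by move=> /derive_mx ->; rewrite mxE. Qed.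

Lemma mulmx_entry p q r (A : V -> 'M[R]_(p, q)) (B : V -> 'M[R]_(q, r)) i j :
  (fun x => (A x *m B x) i j) =
  \sum_(k < q) ((fun x => A x i k) * (fun x => B x k j)).
Proof. by apply/funext => x; rewrite mxE fct_sumE. Qed.

Lemma differentiable_mulmx p q r (A : V -> 'M[R]_(p, q))
    (B : V -> 'M[R]_(q, r)) t :
  differentiable A t -> differentiable B t ->
  differentiable (fun x => A x *m B x) t.
Proof.
move=> /differentiable_mxP dA /differentiable_mxP dB.
apply/differentiable_mxP => i j; rewrite mulmx_entry.
by apply: differentiable_sum => k; exact: differentiableM.
Qed.

Lemma derivable_mulmx p q r (A : V -> 'M[R]_(p, q))
    (B : V -> 'M[R]_(q, r)) t v :
  derivable A t v -> derivable B t v -> derivable (fun x => A x *m B x) t v.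
Proof.
move=> /derivable_mxP dA /derivable_mxP dB.
apply/derivable_mxP => i j; rewrite mulmx_entry.
by apply: derivable_sum => k; exact: derivableM.
Qed.

Lemma derive_mulmx p q r (A : V -> 'M[R]_(p, q))
    (B : V -> 'M[R]_(q, r)) t v :
  derivable A t v -> derivable B t v ->
  'D_v (fun x => A x *m B x) t = 'D_v A t *m B t + A t *m 'D_v B t.
Proof.
move=> dA dB; have dAB := derivable_mulmx dA dB.
have /derivable_mxP cA := dA; have /derivable_mxP cB := dB.
apply/matrixP => i j; rewrite (derive_mxE _ _ dAB) mulmx_entry.
rewrite derive_sum; last by move=> k; exact: derivableM.
rewrite !mxE -big_split; apply: eq_bigr => k _ /=.
rewrite deriveM // !derive_mxE // addrC.
by congr (_ + _); rewrite /GRing.scale /= mulrC.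
Qed.

Lemma derive_mulmxr p q r (A : 'M[R]_(p, q)) (B : V -> 'M[R]_(q, r)) t v :
  derivable B t v -> 'D_v (fun x => A *m B x) t = A *m 'D_v B t.
Proof.
by move=> dB; rewrite (derive_mulmx (derivable_cst _ _ _) dB) derive_cst mul0mx add0r.
Qed.

Lemma differentiable_trmx p q (M : V -> 'M[R]_(p, q)) t :
  differentiable M t -> differentiable (fun x => (M x)^T) t.
Proof.
move=> /differentiable_mxP dM; apply/differentiable_mxP => i j.
by under eq_fun do rewrite mxE; exact: dM.
Qed.

Lemma differentiable_prod (I : Type) (s : seq I) (f : I -> V -> R) t :
  (forall i, differentiable (f i) t) -> differentiable (fun x => \prod_(i <- s) f i x) t.
Proof.
move=> df; elim: s => [|i s IH].
  by under eq_fun do rewrite big_nil; exact: differentiable_cst.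
by under eq_fun do rewrite big_cons; exact: differentiableM.
Qed.

Lemma differentiable_det p (M : V -> 'M[R]_p) t :
  differentiable M t -> differentiable (fun x => \det (M x)) t.
Proof.
move=> /differentiable_mxP dM; rewrite /determinant.
elim: (index_enum _) => [|s l IH].
  by under eq_fun do rewrite big_nil; exact: differentiable_cst.
under eq_fun do rewrite big_cons; apply: differentiableD => //.
apply: differentiableM; first exact: differentiable_cst.
by apply: differentiable_prod.
Qed.

(** The first-order expansion of [f] at [z] is also one of [g], and uniqueness of the differential
    identifies ['d g z] with ['d f z]. *)
Lemma near_eq_differentiable (W : normedModType R) (f g : V -> W) z :
  (\forall x \near z, f x = g x) -> differentiable f z -> differentiable g z.
Proof.
move=> fg df; have fgz : f z = g z := nbhs_singleton fg.
have gE : g \o shift z = cst (g z) + 'd f z +o_ (0 : V) id.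
  apply/eqaddoP => e e0.
  have /eqaddoP /(_ e e0) := diff_locally df.
  apply: filterS2; last by move: fg; rewrite (near_shift 0); exact.
  move=> h /= fgh; rewrite !fctE /= -fgz; suff -> : f (h + z) = g (h + z) by [].
  by move: fgh; rewrite subr0.
have dfg : 'd g z = 'd f z :> (V -> W).
  by apply: diff_unique => //; exact: diff_continuous.
by apply/diff_locallyP; rewrite dfg; split => //; exact: diff_continuous.
Qed.

Lemma differentiable_invmx p (M : V -> 'M[R]_p) t :
  differentiable M t -> M t \in unitmx -> differentiable (fun x => invmx (M x)) t.
Proof.
move=> dM uM; have dd := differentiable_det dM.
have d0 : \det (M t) != 0 by rewrite -unitfE -unitmxE.
(* Cramer's formula holds only where the determinant is nonzero, since [invmx] returns a singular
   matrix unchanged; continuity of the determinant provides a neighbourhood of [t]. *)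
apply: (near_eq_differentiable (f := fun x => (\det (M x))^-1 *: \adj (M x))).
  have : \forall x \near t, \det (M x) != 0.
    exact: cvgr_neq0 (differentiable_continuous dd) d0.
  apply: filterS => x dx; rewrite /invmx unitmxE unitfE dx.
  by [].
apply/differentiable_mxP => i j.
under eq_fun do rewrite !mxE /cofactor.
have /differentiable_mxP cM := dM.
apply: differentiableM; first exact: differentiableV.
apply: differentiableM; first exact: differentiable_cst.
apply: differentiable_det; apply/differentiable_mxP => k l.
by under eq_fun do rewrite !mxE; exact: cM.
Qed.

Lemma derive_comp (W X : normedModType R) (f : V -> W) (g : W -> X) z v :
  differentiable f z -> differentiable g (f z) ->
  'D_v (g \o f) z = 'D_('D_v f z) g (f z).
Proof.
move=> df dg; have dgf := differentiable_comp df dg.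
by rewrite (deriveE _ dgf) (deriveE _ df) (deriveE _ dg) diff_comp.
Qed.

Lemma differentiable_eps (W : normedModType R) (f : V -> W) z :
  differentiable f z -> forall e, 0 < e ->
  exists2 d, 0 < d & forall h, `|h| < d ->
    `|f (z + h) - f z - 'd f z h| <= e * `|h|.
Proof.
move=> df e e0.
have : (fun h => f (z + h)) = (fun h => f z + 'd f z h) +o_ (0 : V) id.
  by apply/eqaddoE/funext => h; rewrite diff_locallyxC.
move=> /eqaddoP /(_ e e0) /nbhs_norm0P [d /= d0 H].
exists d => // h hd; apply: le_trans (H h hd).
by rewrite !fctE opprD addrA.
Qed.

End MatrixCalculus.

(** * Derivatives along lines and symmetry of second derivatives *)

Lemma is_derive_line (R : realType) (V W : normedModType R) (f : V -> W)
    (a u : V) (s : R) : differentiable f (a + s *: u) ->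
  is_derive s (1 : R) (fun t : R => f (a + t *: u)) ('D_u f (a + s *: u)).
Proof.
move=> df.
have dk : differentiable (fun t : R => t *: u) s by exact: differentiableZl.
have dl : differentiable (fun t : R => a + t *: u) s.
  by apply: differentiableD; [exact: differentiable_cst|exact: dk].
have Dl : 'D_1 (fun t : R => a + t *: u) s = u.
  rewrite (deriveE _ dl) (diffD (f := cst a) (differentiable_cst _ _) dk).
  rewrite diff_cst diffZl // -[LHS]/(0 + _) add0r -(@deriveE _ _ _ id) //.
  by rewrite derive_id scale1r.
split.
  by apply: diff_derivable; exact: (@differentiable_comp _ _ _ _ (fun t : R => a + t *: u)).
by rewrite (derive_comp _ dl df) Dl.
Qed.

(** The mean value theorem in the direction [u], applied to the difference of [f] along two parallel
    segments, reduces the second difference to an increment of ['D_u f], which is then expanded at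
    [z]. *)
Lemma second_difference (R : realType) (V : normedModType R) (f : V -> R)
    (z u v : V) :
  (\forall y \near z, differentiable f y) ->
  differentiable (fun y => 'D_u f y) z ->
  forall e, 0 < e -> exists2 d, 0 < d & forall t, 0 < t -> t < d ->
    `|f (z + t *: u + t *: v) - f (z + t *: u) - f (z + t *: v) + f z
      - t ^+ 2 * 'D_v (fun y => 'D_u f y) z| <= e * t ^+ 2.
Proof.
move=> /nbhs_normP [d1 /= d10 df] dp e e0.
pose c := `|u| + `|v|; pose c1 := c + `|u| + 1.
have c0 : 0 <= c by rewrite addr_ge0.
have c10 : 0 < c1 by rewrite /c1 ltr_pwDr // addr_ge0.
have ec0 : 0 < e / c1 by rewrite divr_gt0.
have [d2 d20 dpe] := differentiable_eps dp ec0.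
exists (Num.min d1 d2 / (c + 1)).
  by rewrite divr_gt0 ?lt_min ?d10 //; lra.
move=> t t0; rewrite ltr_pdivlMr; last by lra.
rewrite lt_min => /andP[td1 td2].
have bnd s w : 0 <= s <= t -> `|w| <= `|v| -> `|s *: u + t *: w| <= t * c.
  move=> /andP[s0 st] wv; apply: le_trans (ler_normD _ _) _.
  rewrite !normrZ (ger0_norm s0) (gtr0_norm t0) /c mulrDr.
  by apply: lerD; [apply: ler_wpM2r|apply: ler_wpM2l => //; exact: ltW].
have dfs s w : 0 <= s <= t -> `|w| <= `|v| -> differentiable f (z + t *: w + s *: u).
  move=> st wv; apply: df => /=.
  rewrite -addrA opprD addrA subrr sub0r normrN addrC.
  by apply: le_lt_trans (bnd _ _ st wv) _; lra.
(* The summand [t *: 0] gives both terms the shape covered by [dfs]; the second difference is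
   [phi t - phi 0]. *)
pose phi s := f (z + t *: v + s *: u) - f (z + t *: 0 + s *: u).
pose dphi s := 'D_u f (z + t *: v + s *: u) - 'D_u f (z + t *: 0 + s *: u).
have n0 : `|0 : V| <= `|v| by rewrite normr0.
have dphiP s : 0 <= s <= t -> is_derive s (1 : R) phi (dphi s).
  by move=> st; apply: is_deriveB; apply: is_derive_line; exact: dfs.
have [||s] := @MVT_segment R phi dphi 0 t (ltW t0).
- by move=> x; rewrite in_itv /= => /andP[x0 xt]; apply: dphiP; rewrite !ltW.
- apply: derivable_within_continuous => x; rewrite in_itv /= => xt.
  by have [] := dphiP x xt.
rewrite in_itv /= subr0 => st phiE.
have -> : f (z + t *: u + t *: v) - f (z + t *: u) - f (z + t *: v) + f z =
    phi t - phi 0.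
  rewrite /phi !scaler0 !scale0r !addr0 [z + t *: u + _]addrAC; ring.
rewrite phiE.
have r1 := dpe (s *: u + t *: v); have r2 := dpe (s *: u).
have b1 := bnd s v st (lexx _).
have b2 : `|s *: u| <= t * `|u|.
  rewrite normrZ; case/andP: st => s0 st.
  by rewrite ger0_norm //; apply: ler_wpM2r.
have {}r1 := r1 (le_lt_trans b1 (le_lt_trans (ler_wpM2l (ltW t0) _) td2)).
have {}r2 := r2 (le_lt_trans b2 (le_lt_trans (ler_wpM2l (ltW t0) _) td2)).
have {}r1 := le_trans (r1 ltac:(by rewrite /c; lra)) (ler_wpM2l (ltW ec0) b1).
have uc : `|u| <= c + 1 by rewrite /c; have := normr_ge0 v; lra.
have {}r2 := le_trans (r2 uc) (ler_wpM2l (ltW ec0) b2).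
rewrite linearD in r1; rewrite /dphi scaler0 addr0.
rewrite -(addrA z) (addrC (t *: v)).
rewrite (deriveE v dp); set X := 'd _ _ (t *: v) in r1.
have XE : t ^+ 2 * 'd (fun y => 'D_u f y) z v = t * X.
  by rewrite /X linearZ /= expr2 -mulrA.
rewrite XE; move: r1 r2.
set P := 'D_u f _; set Q := 'D_u f _; set P0 := 'D_u f _.
set Y := 'd _ _ _ => r1 r2.
(* Both values of ['D_u f] are compared with their linear expansions at [z]; the contribution [Y] of
   [s *: u] cancels and two small errors remain. *)
have -> : (P - P0) * t - t * X = t * ((P - Q - (Y + X)) - (P0 - Q - Y)) by ring.
rewrite normrM gtr0_norm // expr2 mulrCA; apply: ler_wpM2l; first exact: ltW.
apply: le_trans (ler_normB _ _) _; apply: le_trans (lerD r1 r2) _.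
have ce : e / c1 * c1 = e by rewrite divfK // gt_eqF.
rewrite -mulrDr -mulrDr -[leRHS](congr1 (fun x => x * t) ce) -mulrA.
by rewrite ler_pM2l // mulrC ler_pM2r // /c1; lra.
Qed.

(** The second difference is symmetric in [u] and [v], so for small [t] both mixed derivatives,
    times [t ^+ 2], lie within [e / 2 * t ^+ 2] of the same number. *)
Lemma schwarz (R : realType) (V : normedModType R) (f : V -> R) (z u v : V) :
  (\forall y \near z, differentiable f y) ->
  differentiable (fun y => 'D_u f y) z ->
  differentiable (fun y => 'D_v f y) z ->
  'D_v (fun y => 'D_u f y) z = 'D_u (fun y => 'D_v f y) z.
Proof.
move=> df du dv; apply/eqP; rewrite -subr_eq0 -normr_le0.
apply/ler_addgt0Pl => e e0; rewrite addr0.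
have e20 : 0 < e / 2 by rewrite divr_gt0.
have [d1 d10 H1] := second_difference v df du e20.
have [d2 d20 H2] := second_difference u df dv e20.
pose t := Num.min d1 d2 / 2.
have m0 : 0 < Num.min d1 d2 by rewrite lt_min d10.
have t0 : 0 < t by rewrite divr_gt0.
have [td1 td2] : t < d1 /\ t < d2.
  by apply/andP; rewrite -lt_min /t; lra.
have {}H1 := H1 t t0 td1; have {}H2 := H2 t t0 td2.
have t20 : 0 < t ^+ 2 by rewrite exprn_gt0.
rewrite -(ler_pM2l t20) -{1}(gtr0_norm t20) -normrM.
move: H1 H2; rewrite [z + t *: v + t *: u]addrAC.
set a := f _; set b := f _; set c := f _.
set P := 'D_v _ _; set Q := 'D_u _ _ => H1 H2.
have -> : t ^+ 2 * (P - Q) = (a - c - b + f z - t ^+ 2 * Q)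
  - (a - b - c + f z - t ^+ 2 * P) by ring.
apply: le_trans (ler_normB _ _) _; apply: le_trans (lerD H2 H1) _.
by rewrite -mulrDl -splitr mulrC.
Qed.

(** * Matrix norm estimates and strict differentiability *)

Section RowVectors.
Context {R : realType}.

Lemma mx_entry_le p q (A : 'M[R]_(p, q)) i j : `|A i j| <= `|A|.
Proof. by rewrite {2}/Num.Def.normr /= mx_normrE; exact: (le_bigmax _ _ (i, j)). Qed.

(** The norm is the largest absolute value of an entry, whence the factor [q]. *)
Lemma mulmx_norm_le p q r (A : 'M[R]_(p, q)) (B : 'M[R]_(q, r)) :
  `|A *m B| <= q%:R * `|A| * `|B|.
Proof.
rewrite {1}/Num.Def.normr /= mx_normrE bigmax_le ?mulr_ge0 // => -[i j] _ /=.
rewrite mxE; apply: le_trans (ler_norm_sum _ _ _) _.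
apply: (@le_trans _ _ (\sum_(k < q) `|A| * `|B|)).
  by apply: ler_sum => k _; rewrite normrM ler_pM // mx_entry_le.
by rewrite sumr_const card_ord -[leLHS]mulr_natl mulrA.
Qed.

Lemma mx_norm_leP p q (A : 'M[R]_(p, q)) e : 0 <= e ->
  (forall i j, `|A i j| <= e) -> `|A| <= e.
Proof.
by move=> e0 H; rewrite /Num.Def.normr /= mx_normrE bigmax_le // => -[i j] _ /=.
Qed.

(** The mean value theorem for each component on the segment from [y] to [x] produces the Jacobian
    at an intermediate point, which continuity keeps close to the one at [z]. Uniformity in both [x]
    and [y] is what makes the map used for level sets a contraction. *)
Lemma differentiable_strict m k (f : 'rV[R]_m -> 'rV[R]_k) z :
  (\forall y \near z, differentiable f y) -> {for z, continuous (jacobian f)} ->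
  forall e, 0 < e -> exists2 d, 0 < d & forall x y, `|x - z| < d -> `|y - z| < d ->
    `|f x - f y - (x - y) *m jacobian f z| <= e * `|x - y|.
Proof.
move=> /nbhs_normP [d1 /= d10 df] cF e e0.
(* The denominator absorbs the factor [m] of [mulmx_norm_le] and stays positive for [m = 0]. *)
have e10 : 0 < e / (m%:R + 1) by rewrite divr_gt0 // ltr_pwDr.
move/cvgrPdist_le : cF => /(_ _ e10) /nbhs_normP [d2 /= d20 Fe].
exists (Num.min d1 d2); first by rewrite lt_min d10.
move=> x y; rewrite !lt_min => /andP[x1 x2] /andP[y1 y2].
apply: mx_norm_leP => [|i j]; first by rewrite mulr_ge0 // ltW.
have conv (d s : R) : `|x - z| < d -> `|y - z| < d -> 0 <= s <= 1 ->
    `|z - (y + s *: (x - y))| < d.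
  move=> xd yd /andP[s0 s1]; rewrite distrC.
  have -> : y + s *: (x - y) - z = s *: (x - z) + (1 - s) *: (y - z).
    by apply/matrixP => a b; rewrite !mxE; ring.
  apply: le_lt_trans (ler_normD _ _) _.
  rewrite !normrZ (ger0_norm s0) (@ger0_norm _ (1 - s)) ?subr_ge0 //.
  have h1 : s * `|x - z| <= s * Num.max `|x - z| `|y - z|.
    by apply: ler_wpM2l => //; rewrite le_max lexx.
  have h2 : (1 - s) * `|y - z| <= (1 - s) * Num.max `|x - z| `|y - z|.
    by apply: ler_wpM2l; rewrite ?subr_ge0 // le_max lexx orbT.
  apply: le_lt_trans (lerD h1 h2) _.
  by rewrite -mulrDl addrC subrK mul1r gt_max xd yd.
pose phi (s : R) := f (y + s *: (x - y)) i j.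
pose dphi (s : R) := ((x - y) *m jacobian f (y + s *: (x - y))) i j.
have dphiP (s : R) : 0 <= s <= 1 -> is_derive s (1 : R) phi (dphi s).
  move=> s01; have dfs := df _ (conv _ _ x1 y1 s01).
  rewrite /dphi -deriveEjacobian // derive_mxE; last exact: diff_derivable.
  apply: (@is_derive_line _ _ _ (fun w => f w i j)).
  by apply (differentiable_mxP f).
have [||s] := @MVT_segment R phi dphi 0 1 ler01.
- by move=> s; rewrite in_itv /= => /andP[s0 s1]; apply: dphiP; rewrite !ltW.
- apply: derivable_within_continuous => s; rewrite in_itv /= => s01.
  by have [] := dphiP s s01.
rewrite in_itv /= subr0 mulr1 => s01.
rewrite /phi scale0r addr0 scale1r [y + _]addrC subrK => fE.
have -> : (f x - f y - (x - y) *m jacobian f z) i j =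
    ((x - y) *m (jacobian f (y + s *: (x - y)) - jacobian f z)) i j.
  by rewrite mulmxBr -/(dphi s) mxE [in RHS]mxE -/(dphi s) -fE !mxE.
apply: le_trans (mx_entry_le _ _ _) _; apply: le_trans (mulmx_norm_le _ _) _.
have Fs : `|jacobian f z - jacobian f (y + s *: (x - y))| <= e / (m%:R + 1).
  by apply: Fe; exact: conv.
rewrite distrC in Fs.
apply: (@le_trans _ _ (m%:R * `|x - y| * (e / (m%:R + 1)))).
  by apply: ler_wpM2l => //; rewrite mulr_ge0.
rewrite mulrAC [leLHS]mulrC [leRHS]mulrC; apply: ler_wpM2l => //.
by rewrite mulrCA ler_piMr ?ltW // ltr_pdivrMr ?ltr_pwDr // mul1r ltrDl.
Qed.
End RowVectors.

(** * Curves in level sets *)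

Section LevelSets.
Context {R : realType}.

(* Banach's fixed point theorem for [w |-> w - (f (z + t *: v + w *m P) - f z)],
   a contraction because [P] is a right inverse of the differential. *)
Lemma level_set_approx m k (f : 'rV[R]_m -> 'rV[R]_k) z (P : 'M[R]_(k, m)) :
  (\forall y \near z, differentiable f y) -> {for z, continuous (jacobian f)} ->
  P *m jacobian f z = 1%:M -> forall v, v *m jacobian f z = 0 ->
  exists2 d, 0 < d & forall t : R, `|t| < d ->
    exists2 w : 'rV[R]_k, `|w| <= `|t| & f (z + t *: v + w *m P) = f z.
Proof.
move=> df cF PF v vF.
pose c := `|v| + k%:R * `|P|.
have kP0 : 0 <= k%:R * `|P| by rewrite mulr_ge0.
have c0 : 0 <= c by rewrite addr_ge0.
(* This [e] makes [Phi] Lipschitz with constant 1/2 and bounds [Phi 0] by half the absolute value of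
   [t]; together these keep the ball [U] stable. *)
pose e : R := (2 * (c + 1))^-1.
have e0 : 0 < e by rewrite invr_gt0; lra.
have ec (x : R) : x <= c -> e * x <= 2^-1.
  move=> xc; rewrite mulrC ler_pdivrMr; last by lra.
  lra.
have [d d0 strict] := differentiable_strict df cF e0.
exists (d / (c + 1)); first by rewrite divr_gt0 //; lra.
move=> t; rewrite ltr_pdivlMr; last by lra.
move=> td.
pose U : set 'rV[R]_k := [set w | `|w| <= `|t|].
pose Phi (w : 'rV[R]_k) := w - (f (z + t *: v + w *m P) - f z).
have wP (w : 'rV[R]_k) : `|w *m P| <= k%:R * `|P| * `|w|.
  by apply: le_trans (mulmx_norm_le _ _) _; rewrite mulrAC.
have near_z w : U w -> `|z + t *: v + w *m P - z| < d.
  rewrite /U /= => wt; have -> : z + t *: v + w *m P - z = t *: v + w *m P.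
    by apply/matrixP => i j; rewrite !mxE; ring.
  apply: le_lt_trans (ler_normD _ _) _; apply: le_lt_trans td.
  rewrite normrZ; apply: (@le_trans _ _ (`|t| * c)).
    rewrite /c mulrDr; apply: lerD => //; apply: le_trans (wP w) _.
    by rewrite mulrC; apply: ler_wpM2r.
  by rewrite ler_wpM2l // lerDl.
have contr w w' : U w -> U w' -> `|Phi w - Phi w'| <= 2^-1 * `|w - w'|.
  move=> Uw Uw'; have := strict _ _ (near_z _ Uw) (near_z _ Uw').
  have -> : z + t *: v + w *m P - (z + t *: v + w' *m P) = (w - w') *m P.
    by rewrite opprD addrACA subrr add0r mulmxBl.
  rewrite -mulmxA PF mulmx1 -normrN => H.
  have -> : Phi w - Phi w' = - (f (z + t *: v + w *m P) -
     f (z + t *: v + w' *m P) - (w - w')).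
    by apply/matrixP => i j; rewrite !mxE; ring.
  apply: le_trans H _; apply: le_trans (ler_wpM2l (ltW e0) (wP _)) _.
  rewrite mulrA ler_wpM2r // ec // /c; have := normr_ge0 v; lra.
have Phi0 : `|Phi 0| <= 2^-1 * `|t|.
  have U0 : U 0 by rewrite /U /= normr0.
  have := strict _ _ (near_z _ U0) (_ : `|z - z| < d).
  rewrite subrr normr0 => /(_ d0).
  rewrite /Phi mul0mx !addr0 sub0r normrN.
  have -> : z + t *: v - z = t *: v by rewrite addrAC subrr add0r.
  rewrite -scalemxAl vF scaler0 subr0 => /le_trans; apply.
  rewrite normrZ mulrCA mulrC ler_wpM2r // ec // /c; lra.
have UPhi w : U w -> U (Phi w).
  move=> Uw; rewrite /U /=.
  have U0 : U 0 by rewrite /U /= normr0.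
  have := contr _ _ Uw U0; rewrite subr0 => H.
  rewrite -[Phi w](subrK (Phi 0)); apply: le_trans (ler_normD _ _) _.
  move: Uw; rewrite /U /= => Uw; lra.
pose X : completeNormedModType R :=
  HB.pack 'rV[R]_k (Complete.on 'rV[R]_k) (NormedModule.on 'rV[R]_k).
pose PhiF : {fun (U : set X) >-> (U : set X)} :=
  HB.pack (Phi : X -> X) (isFun.Build X X U U Phi UPhi).
have Pc : is_contraction PhiF.
  exists (2^-1)%:nng; split => /=; first by lra.
  by move=> [w w'] [/= Uw Uw']; exact: contr.
have [||w Uw wE] := banach_fixed_point Pc.
- apply: (@preimage_closed _ _ (fun w : X => `|w|) [set x : R | x <= `|t|]).
    by move=> w _; exact: (@norm_continuous _ X).
  exact: closed_le.
- by exists 0; rewrite /U /= normr0.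
have {}wE : w = Phi w := wE.
exists w => //; apply/eqP; rewrite -subr_eq0; apply/eqP.
have -> : f (z + t *: v + w *m P) - f z = w - Phi w.
  by rewrite /Phi opprB [RHS]addrC subrK.
by rewrite -wE subrr.
Qed.

(** The curve is [z + t *: v + w t *m P], with a correction [w t] chosen separately for each [t]. It
    has velocity [v] at 0 because the expansion of [f] at [z], where [f] does not change along the
    curve, forces [w t] to be o(t). *)
Lemma level_set_curve m k (f : 'rV[R]_m -> 'rV[R]_k) z (P : 'M[R]_(k, m)) :
  (\forall y \near z, differentiable f y) -> {for z, continuous (jacobian f)} ->
  P *m jacobian f z = 1%:M -> forall v, v *m jacobian f z = 0 ->
  exists gamma : R -> 'rV[R]_m, [/\ gamma 0 = z,
    \forall t \near (0 : R), f (gamma t) = f z & is_derive (0 : R) (1 : R) gamma v].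
Proof.
move=> df cF PF v vF.
have [d d0 sol] := level_set_approx df cF PF vF.
(* The bound on [t] moves inside the existential, with the default value 0 for large [t], so that
   [w] can be chosen for every [t]. *)
have {}sol t : exists w : 'rV[R]_k,
    `|t| < d -> `|w| <= `|t| /\ f (z + t *: v + w *m P) = f z.
  have [/sol [w wt fw]|] := ltP `|t| d; first by exists w.
  by exists 0.
pose w t := projT1 (cid (sol t)).
have wP t : `|t| < d -> `|w t| <= `|t| /\ f (z + t *: v + w t *m P) = f z.
  exact: projT2 (cid (sol t)).
have w0 : w 0 = 0.
  have [] := wP 0 _; rewrite normr0 // => w0 _.
  by apply/eqP; rewrite -normr_le0.
pose c := `|v| + k%:R * `|P|.
have c0 : 0 <= c by rewrite addr_ge0 // mulr_ge0.
have bnd t : `|t| < d -> `|t *: v + w t *m P| <= c * `|t|.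
  move=> td; have [wt _] := wP t td.
  apply: le_trans (ler_normD _ _) _; rewrite /c mulrDl normrZ mulrC lerD //.
  apply: le_trans (mulmx_norm_le _ _) _; rewrite mulrAC.
  by apply: ler_wpM2l => //; rewrite mulr_ge0.
have dfz : differentiable f z := nbhs_singleton df.
pose g t := z + t *: v + w t *m P.
have dg : is_derive (0 : R) (1 : R) g v.
  (* [q] exceeds by 1 the product of the constants met in bounding [w h *m P], so that the final
     factor [(q - 1) / q] is at most 1. *)
  pose q := k%:R * `|P| * c + 1.
  have q0 : 0 < q by rewrite ltr_pwDr // !mulr_ge0.
  have gv : h^-1 *: ((g \o shift 0) (h *: (1 : R)) - g 0) @[h --> (0 : R)^'] --> v.
    apply/cvgrPdist_le => e e0.
    have eq0 : 0 < e / q by rewrite divr_gt0.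
    have [d1 d10 dfe] := differentiable_eps dfz eq0.
    have : \forall h \near (0 : R)^', h != 0 by exact: nbhs_dnbhs_neq.
    have : \forall h \near (0 : R)^', `|h| < Num.min d (d1 / (c + 1)).
      by apply: dnbhs0_lt; rewrite lt_min d0 divr_gt0 // ltr_pwDr.
    apply: filterS2 => h; rewrite lt_min => /andP[hd].
    rewrite ltr_pdivlMr ?ltr_pwDr // => hd1 h0.
    have [wh fh] := wP h hd.
    have -> : v - h^-1 *: ((g \o shift 0) (h *: (1 : R)) - g 0) = - (h^-1 *: (w h *m P)).
      rewrite /g /= addr0 [h *: 1]mulr1 w0 mul0mx scale0r !addr0.
      have -> : z + h *: v + w h *m P - z = h *: v + w h *m P.
        by apply/matrixP => i j; rewrite !mxE; ring.
      by rewrite scalerDr scalerA mulVf // scale1r opprD addrA subrr add0r.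
    rewrite normrN normrZ normfV ler_pdivrMl ?normr_gt0 //.
    have small : `|h *: v + w h *m P| < d1.
      apply: le_lt_trans (bnd h hd) _; apply: le_lt_trans hd1.
      by rewrite mulrC ler_wpM2l // lerDl.
    (* The increment of [f] is zero, [v] lies in the kernel and [P] is a right inverse, so up to
       sign the first-order error is [w h] itself. *)
    have := dfe _ small; rewrite addrA fh subrr sub0r normrN -deriveE //.
    rewrite deriveEjacobian // mulmxDl -scalemxAl vF scaler0 add0r -mulmxA PF mulmx1.
    move=> /le_trans /(_ (ler_wpM2l (ltW eq0) (bnd h hd))) wle.
    apply: le_trans (mulmx_norm_le _ _) _.
    rewrite mulrAC; apply: le_trans (ler_wpM2l _ wle) _; first by rewrite mulr_ge0.
    have -> : k%:R * `|P| * (e / q * (c * `|h|)) = `|h| * e * ((q - 1) / q).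
      by rewrite /q; ring.
    by rewrite ler_piMr ?mulr_ge0 // ?(ltW e0) // ler_pdivrMr // mul1r gerBl.
  apply: DeriveDef; first by apply/cvg_ex; exists v.
  by apply/cvg_lim.
exists g; split => //.
  by rewrite /g scale0r w0 mul0mx !addr0.
by apply/nbhs_norm0P; exists d => // t /= /wP [].
Qed.
End LevelSets.

(** * Smooth functions *)

Section Smoothness.
Context {R : realType} {m : nat}.
Implicit Types (U : set 'rV[R]_m).

Lemma open_near U z (P : 'rV[R]_m -> Prop) : open U -> U z ->
  (forall y, U y -> P y) -> \forall y \near z, P y.
Proof.
by move=> oU Uz UP; apply: filterS UP _; exact: open_nbhs_nbhs.
Qed.

(** By induction on the list of indices, every iterated partial derivative agrees on [U] with a
    member of [C]. This replaces explicit formulas for higher derivatives by a closure property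
    under first ones. *)
Lemma smooth_on_coind (W : normedModType R) U (C : ('rV[R]_m -> W) -> Prop) :
  open U -> (forall f, C f -> forall z, U z -> differentiable f z) ->
  (forall f, C f -> forall i, exists2 g, C g &
    forall z, U z -> 'D_(ebase i) f z = g z) ->
  forall f, C f -> smooth_on U f.
Proof.
move=> oU Cdiff Cder f Cf s.
have [g Cg fg] : exists2 g, C g & forall z, U z -> iter_partial s f z = g z.
  elim: s => [|i s [g Cg fg]]; first by exists f.
  have [g' Cg' gg'] := Cder g Cg i; exists g' => // z Uz /=.
  by rewrite -gg' //; apply: near_eq_derive; exact: open_near oU Uz _.
move=> z Uz; apply: near_eq_differentiable (Cdiff g Cg z Uz).
by apply: open_near oU Uz _ => y Uy; rewrite fg.
Qed.

Lemma smooth_on_differentiable (W : normedModType R) U (f : 'rV[R]_m -> W) z :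
  smooth_on U f -> U z -> differentiable f z.
Proof. by move=> sf; exact: (sf [::]). Qed.

Lemma smooth_on_partial (W : normedModType R) U (f : 'rV[R]_m -> W) i :
  smooth_on U f -> smooth_on U (fun z => 'D_(ebase i) f z).
Proof.
(* [iter_partial] differentiates along the last index of the list first. *)
move=> sf s z Uz; have := sf (rcons s i) z Uz.
suff -> : iter_partial (rcons s i) f = iter_partial s (fun z => 'D_(ebase i) f z) by [].
by elim: s => //= j s ->.
Qed.

Lemma eq_smooth_on (W : normedModType R) U (f g : 'rV[R]_m -> W) :
  open U -> (forall z, U z -> f z = g z) -> smooth_on U f -> smooth_on U g.
Proof.
move=> oU fg sf.
pose C (h : 'rV[R]_m -> W) := exists2 k, smooth_on U k & forall z, U z -> k z = h z.
apply: (@smooth_on_coind _ _ C) => //; last by exists f.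
  move=> h [k sk kh] z Uz.
  apply: near_eq_differentiable (smooth_on_differentiable sk Uz).
  exact: open_near oU Uz kh.
move=> h [k sk kh] i; exists (fun z => 'D_(ebase i) k z).
  exists (fun z => 'D_(ebase i) k z) => //.
  exact: smooth_on_partial.
by move=> z Uz; apply: near_eq_derive; apply: open_near oU Uz _ => y /kh ->.
Qed.

Lemma smooth_on_mxP p q U (M : 'rV[R]_m -> 'M[R]_(p, q)) : open U ->
  smooth_on U M <-> forall i j, smooth_on U (fun z => M z i j).
Proof.
move=> oU; split=> [sM i j|].
  pose C (f : 'rV[R]_m -> R) :=
    exists2 M : 'rV[R]_m -> 'M[R]_(p, q), smooth_on U M & f = fun z => M z i j.
  apply: (@smooth_on_coind _ _ C) => //; last by exists M.
    move=> f [N sN ->] z Uz.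
    exact: (differentiable_mxP N z).1 (smooth_on_differentiable sN Uz) i j.
  move=> f [N sN ->] k; exists (fun z => 'D_(ebase k) N z i j).
    by exists (fun z => 'D_(ebase k) N z) => //; exact: smooth_on_partial.
  move=> z Uz; rewrite derive_mxE //; apply: diff_derivable.
  exact: smooth_on_differentiable sN Uz.
pose C (N : 'rV[R]_m -> 'M[R]_(p, q)) := forall i j, smooth_on U (fun z => N z i j).
move=> CM; apply: (@smooth_on_coind _ _ C) => // {CM M}.
  move=> N sN z Uz; apply/differentiable_mxP => i j.
  exact: smooth_on_differentiable (sN i j) Uz.
move=> N sN k; exists (fun z => 'D_(ebase k) N z) => // i j.
apply: eq_smooth_on oU _ (smooth_on_partial k (sN i j)) => z Uz.
rewrite derive_mxE //; apply: diff_derivable; apply/differentiable_mxP => i' j'.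
exact: smooth_on_differentiable (sN i' j') Uz.
Qed.

(** Polynomial expressions in smooth functions: by the sum and product rules their partial
    derivatives agree on [U] with such expressions, as [smooth_on_coind] requires. *)
Inductive smooth_algebra U : ('rV[R]_m -> R) -> Prop :=
| SmoothGen f : smooth_on U f -> smooth_algebra U f
| SmoothCst c : smooth_algebra U (cst c)
| SmoothAdd f g : smooth_algebra U f -> smooth_algebra U g -> smooth_algebra U (f + g)
| SmoothMul f g : smooth_algebra U f -> smooth_algebra U g -> smooth_algebra U (f * g).

Lemma smooth_algebraP U f : open U -> smooth_algebra U f -> smooth_on U f.
Proof.
move=> oU; have dif g : smooth_algebra U g -> forall z, U z -> differentiable g z.
  elim=> [h sh|c|h k _ dh _ dk|h k _ dh _ dk] z Uz.
  - exact: smooth_on_differentiable sh Uz.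
  - exact: differentiable_cst.
  - by apply: differentiableD; [exact: dh|exact: dk].
  - by apply: differentiableM; [exact: dh|exact: dk].
apply: smooth_on_coind => // g sg i.
elim: sg => [h sh|c|h k sh [h' sh' hh'] sk [k' sk' kk']|h k sh [h' sh' hh'] sk [k' sk' kk']].
- by exists (fun z => 'D_(ebase i) h z) => //; apply: SmoothGen; exact: smooth_on_partial.
- by exists (cst 0); [exact: SmoothCst|move=> z _; rewrite derive_cst].
- exists (h' + k'); first exact: SmoothAdd.
  by move=> z Uz; rewrite deriveD ?hh' ?kk' //; apply: diff_derivable; exact: dif.
- exists (h * k' + k * h').
    by apply: SmoothAdd; exact: SmoothMul.
  by move=> z Uz; rewrite deriveM ?hh' ?kk' //; apply: diff_derivable; exact: dif.
Qed.

Lemma smooth_on_cst U (c : R) : open U -> smooth_on U (fun=> c).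
Proof. by move=> oU; apply: smooth_algebraP => //; exact: SmoothCst. Qed.

Lemma smooth_onD U (f g : 'rV[R]_m -> R) : open U -> smooth_on U f ->
  smooth_on U g -> smooth_on U (fun z => f z + g z).
Proof.
move=> oU sf sg; apply: smooth_algebraP => //.
by apply: SmoothAdd; exact: SmoothGen.
Qed.

Lemma smooth_onM U (f g : 'rV[R]_m -> R) : open U -> smooth_on U f ->
  smooth_on U g -> smooth_on U (fun z => f z * g z).
Proof.
move=> oU sf sg; apply: smooth_algebraP => //.
by apply: SmoothMul; exact: SmoothGen.
Qed.

Lemma smooth_on_sum U (I : Type) (s : seq I) (f : I -> 'rV[R]_m -> R) :
  open U -> (forall i, smooth_on U (f i)) -> smooth_on U (fun z => \sum_(i <- s) f i z).
Proof.
move=> oU sf; elim: s => [|i s IH].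
  by under eq_fun do rewrite big_nil; exact: smooth_on_cst.
by under eq_fun do rewrite big_cons; exact: smooth_onD.
Qed.

Lemma smooth_on_prod U (I : Type) (s : seq I) (f : I -> 'rV[R]_m -> R) :
  open U -> (forall i, smooth_on U (f i)) -> smooth_on U (fun z => \prod_(i <- s) f i z).
Proof.
move=> oU sf; elim: s => [|i s IH].
  by under eq_fun do rewrite big_nil; exact: smooth_on_cst.
by under eq_fun do rewrite big_cons; exact: smooth_onM.
Qed.

Lemma smooth_on_mulmx p q r U (A : 'rV[R]_m -> 'M[R]_(p, q))
    (B : 'rV[R]_m -> 'M[R]_(q, r)) : open U ->
  smooth_on U A -> smooth_on U B -> smooth_on U (fun z => A z *m B z).
Proof.
move=> oU /(smooth_on_mxP _ oU) sA /(smooth_on_mxP _ oU) sB.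
apply/(smooth_on_mxP _ oU) => i j; under eq_fun do rewrite mxE.
by apply: smooth_on_sum => // k; exact: smooth_onM.
Qed.

Lemma smooth_on_cstmx p q U (A : 'M[R]_(p, q)) : open U -> smooth_on U (fun=> A).
Proof. by move=> oU; apply/(smooth_on_mxP _ oU) => i j; exact: smooth_on_cst. Qed.

Lemma smooth_onDmx p q U (A B : 'rV[R]_m -> 'M[R]_(p, q)) : open U ->
  smooth_on U A -> smooth_on U B -> smooth_on U (fun z => A z + B z).
Proof.
move=> oU /(smooth_on_mxP _ oU) sA /(smooth_on_mxP _ oU) sB.
apply/(smooth_on_mxP _ oU) => i j; under eq_fun do rewrite mxE.
exact: smooth_onD.
Qed.

Lemma smooth_onZmx p q U (c : 'rV[R]_m -> R) (A : 'rV[R]_m -> 'M[R]_(p, q)) : open U ->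
  smooth_on U c -> smooth_on U A -> smooth_on U (fun z => c z *: A z).
Proof.
move=> oU sc /(smooth_on_mxP _ oU) sA.
apply/(smooth_on_mxP _ oU) => i j; under eq_fun do rewrite mxE.
exact: smooth_onM.
Qed.

Lemma smooth_on_trmx p q U (A : 'rV[R]_m -> 'M[R]_(p, q)) : open U ->
  smooth_on U A -> smooth_on U (fun z => (A z)^T).
Proof.
move=> oU /(smooth_on_mxP _ oU) sA.
by apply/(smooth_on_mxP _ oU) => i j; under eq_fun do rewrite mxE; exact: sA.
Qed.

Lemma smooth_on_det p U (A : 'rV[R]_m -> 'M[R]_p) : open U ->
  smooth_on U A -> smooth_on U (fun z => \det (A z)).
Proof.
move=> oU /(smooth_on_mxP _ oU) sA; rewrite /determinant.
apply: smooth_on_sum => // s; apply: smooth_onM => //; first exact: smooth_on_cst.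
exact: smooth_on_prod.
Qed.

Lemma smooth_on_adj p U (A : 'rV[R]_m -> 'M[R]_p) : open U ->
  smooth_on U A -> smooth_on U (fun z => \adj (A z)).
Proof.
move=> oU /(smooth_on_mxP _ oU) sA.
apply/(smooth_on_mxP _ oU) => i j; under eq_fun do rewrite mxE.
apply: smooth_onM => //; first exact: smooth_on_cst.
apply: smooth_on_det => //; apply/(smooth_on_mxP _ oU) => k l.
by under eq_fun do rewrite !mxE; exact: sA.
Qed.

Lemma jacobian_row k (f : 'rV[R]_m -> 'rV[R]_k) z i j : differentiable f z ->
  jacobian f z i j = 'D_(ebase i) f z 0 j.
Proof.
by move=> df; rewrite deriveEjacobian // /ebase -rowE [RHS]mxE.
Qed.

Lemma smooth_on_jacobian k U (f : 'rV[R]_m -> 'rV[R]_k) : open U ->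
  smooth_on U f -> smooth_on U (jacobian f).
Proof.
move=> oU sf; apply/(smooth_on_mxP _ oU) => i j.
apply: (eq_smooth_on oU) (_ : smooth_on U (fun z => 'D_(ebase i) f z 0 j)).
  by move=> z Uz; rewrite jacobian_row //; exact: smooth_on_differentiable sf Uz.
exact: (smooth_on_mxP _ oU).1 (smooth_on_partial i sf) 0 j.
Qed.

End Smoothness.

(** * Linear algebra of a submersion *)

Section LinearAlgebra.
Context {R : realType}.

Lemma mx_form_inj p q (X Y : 'M[R]_(p, q)) :
  (forall (u : 'rV_p) (v : 'rV_q), (u *m X *m v^T) 0 0 = (u *m Y *m v^T) 0 0) -> X = Y.
Proof.
move=> XY; apply/matrixP => i j.
have := XY (delta_mx 0 i) (delta_mx 0 j).
by rewrite trmx_delta -!rowE -!colE !mxE.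
Qed.

Lemma bilinear_formE m (b : 'rV[R]_m -> 'rV[R]_m -> R) :
  (forall v a u u', b (a *: u + u') v = a * b u v + b u' v) ->
  (forall u a v v', b u (a *: v + v') = a * b u v + b u v') ->
  forall u v, b u v = (u *m \matrix_(i, j) b (ebase i) (ebase j) *m v^T) 0 0.
Proof.
move=> bl br u v.
have bl0 w : b 0 w = 0 by have := bl w 1 0 0; rewrite scaler0 addr0; lra.
have br0 w : b w 0 = 0 by have := br w 1 0 0; rewrite scaler0 addr0; lra.
have suml (I : Type) (s : seq I) (c : I -> R) (x : I -> 'rV[R]_m) w :
    b (\sum_(i <- s) c i *: x i) w = \sum_(i <- s) c i * b (x i) w.
  by elim: s => [|i s IH]; rewrite ?big_nil ?bl0 // !big_cons bl IH.
have sumr (I : Type) (s : seq I) (c : I -> R) (x : I -> 'rV[R]_m) w :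
    b w (\sum_(i <- s) c i *: x i) = \sum_(i <- s) c i * b w (x i).
  by elim: s => [|i s IH]; rewrite ?big_nil ?br0 // !big_cons br IH.
rewrite [u in LHS]row_sum_delta [v in LHS]row_sum_delta suml.
rewrite -mulmxA mxE; apply: eq_bigr => i _; rewrite sumr mxE; congr (_ * _).
by apply: eq_bigr => j _; rewrite !mxE mulrC.
Qed.

Lemma posdef_unitmx m (G : 'M[R]_m) :
  (forall v, v != 0 -> 0 < inner G v v) -> G \in unitmx.
Proof.
move=> pos; rewrite -row_free_unit -kermx_eq0; apply/eqP/row_matrixP => i.
rewrite row0; apply/eqP/negP => /negP nz; have := pos _ nz.
by rewrite /inner -row_mul mulmx_ker row0 mul0mx mxE ltxx.
Qed.

Lemma gram_rows m r (G : 'M[R]_m) (E : 'M[R]_(r, m)) i j :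
  (E *m G *m E^T) i j = inner G (row i E) (row j E).
Proof.
rewrite /inner -row_mul mxE [RHS]mxE; apply: eq_bigr => l _.
by congr (_ * _); rewrite !mxE.
Qed.

(** An orthonormal family in the kernel of maximal size is taken; the size is at most [m] since [E]
    has a right inverse. If some kernel vector differed from its projection, the normalized
    difference would extend the family. *)
Lemma orthonormal_kernel m k (G : 'M[R]_m) (F : 'M[R]_(m, k)) :
  G^T = G -> (forall v, v != 0 -> 0 < inner G v v) ->
  exists r (E : 'M[R]_(r, m)), [/\ E *m F = 0, E *m G *m E^T = 1%:M &
    forall v : 'rV_m, v *m F = 0 -> v = v *m G *m E^T *m E].
Proof.
move=> Gsym pos.
pose P r := `[< exists E : 'M[R]_(r, m), E *m F = 0 /\ E *m G *m E^T = 1%:M >].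
have P0 : exists r, P r.
  exists 0; apply/asboolP; exists 0; rewrite !mul0mx; split => //.
  by apply/matrixP => -[].
have Pm r : P r -> (r <= m)%N.
  by move=> /asboolP [E [_]]; rewrite -mulmxA => /mulmx1_min.
case: (ex_maxnP P0 Pm) => r /asboolP [E [EF EG]] rmax.
exists r, E; split => // v vF.
pose w := v - v *m G *m E^T *m E.
have wF : w *m F = 0 by rewrite mulmxBl vF -(mulmxA _ E F) EF mulmx0 subr0.
have wE : w *m G *m E^T = 0.
  rewrite !mulmxBl -!mulmxA; apply/eqP; rewrite subr_eq0; apply/eqP.
  by rewrite (mulmxA E) EG mulmx1.
have [/eqP|w0] := eqVneq w 0; first by rewrite subr_eq0 => /eqP.
have q0 := pos w w0; pose q := inner G w w.
pose e := (Num.sqrt q)^-1 *: w.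
have : (r + 1 <= r)%N; last by rewrite addn1 ltnn.
apply: rmax; apply/asboolP; exists (col_mx E e); split.
  by rewrite mul_col_mx EF /e -scalemxAl wF scaler0 col_mx0.
rewrite mul_col_mx tr_col_mx mul_col_row EG.
have eE : e *m G *m E^T = 0 by rewrite /e -!scalemxAl wE scaler0.
have Ee : E *m G *m e^T = 0.
  by apply: trmx_inj; rewrite trmx0 !trmx_mul trmxK Gsym mulmxA.
have ee : e *m G *m e^T = 1%:M.
  rewrite /e linearZ /= -!scalemxAl -scalemxAr scalerA.
  rewrite [w *m G *m w^T]mx11_scalar -/(inner G w w) -/q scale_scalar_mx.
  rewrite -invfM -expr2 sqr_sqrtr ?mulVf //; first by rewrite gt_eqF.
  exact: ltW.
by rewrite eE Ee ee -scalar_mx_block.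
Qed.

(** * Horizontal and vertical parts of the inverse metric *)

Section Cometric.
Context {m k : nat} (G : 'M[R]_m) (H : 'M[R]_k) (F : 'M[R]_(m, k))
  (A : 'M[R]_(k, m)) (AE : A = H *m F^T *m invmx G).

(** If [w] is in the kernel of [F^T *m invmx G *m F], then [w *m F^T *m invmx G] has length zero for
    [G], so [w *m F^T = 0]. Writing [w = u *m F] by surjectivity gives [w *m w^T = 0]. *)
Lemma horizontal_gram_unit (Gsym : G^T = G)
  (Gpos : forall v, v != 0 -> 0 < inner G v v) (Hu : H \in unitmx)
  (Fsurj : forall w : 'rV_k, exists u, u *m F = w) : A *m F \in unitmx.
Proof.
have Gu := posdef_unitmx Gpos.
have -> : A *m F = H *m (F^T *m invmx G *m F) by rewrite AE !mulmxA.
rewrite unitmx_mul Hu /= -row_free_unit -kermx_eq0; apply/eqP.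
suff inj (w : 'rV_k) : w *m (F^T *m invmx G *m F) = 0 -> w = 0.
  by apply/row_matrixP => i; rewrite row0; apply: inj; rewrite -row_mul mulmx_ker row0.
move=> wK.
pose y := w *m F^T *m invmx G.
have yT : y^T = invmx G *m F *m w^T.
  by rewrite /y !trmx_mul trmxK trmx_inv Gsym !mulmxA.
have yGy : y *m G *m y^T = 0.
  by rewrite yT /y mulmxKV // !mulmxA; rewrite !mulmxA in wK; rewrite wK mul0mx.
have y0 : y = 0.
  by apply/eqP/negP => /negP /Gpos; rewrite /inner yGy mxE ltxx.
have wF : w *m F^T = 0 by rewrite -(mulmxKV Gu (w *m F^T)) -/y y0 mul0mx.
have [u uF] := Fsurj w.
have : w *m w^T = 0 by rewrite -{2}uF trmx_mul mulmxA wF mul0mx.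
move=> /matrixP /(_ 0 0); rewrite !mxE => /eqP; rewrite psumr_eq0; last first.
  by move=> j _; rewrite mxE -expr2 sqr_ge0.
move=> /allP wj; apply/rowP => j; rewrite mxE.
have := wj j (mem_index_enum _); by rewrite mxE -expr2 sqrf_eq0 => /eqP.
Qed.

(** [T] is the projection onto the kernel of [F] along the horizontal space, the row space of [A].
    Its rows expand in [E], and [A *m G *m E^T = 0] reduces this to [T = G *m E^T *m E]; multiplying
    by [invmx G] gives the splitting. *)
Lemma cometric_split r (E : 'M[R]_(r, m)) (Gsym : G^T = G) (Hsym : H^T = H)
  (Gu : G \in unitmx) (Hu : H \in unitmx) (Su : A *m F \in unitmx) :
  E *m F = 0 -> E *m G *m E^T = 1%:M ->
  (forall v : 'rV_m, v *m F = 0 -> v = v *m G *m E^T *m E) ->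
  invmx G = A^T *m (invmx H *m invmx (A *m F)) *m A + E^T *m E.
Proof.
move=> EF EG Efull.
pose T := 1%:M - F *m invmx (A *m F) *m A.
have TF : T *m F = 0 by rewrite mulmxBl mul1mx -!mulmxA mulVmx // mulmx1 subrr.
have TE : T = T *m G *m E^T *m E.
  apply/row_matrixP => i; rewrite !row_mul; apply: Efull.
  by rewrite -row_mul TF row0.
have AGE : A *m G *m E^T = 0.
  by rewrite AE mulmxKV // -mulmxA -trmx_mul EF trmx0 mulmx0.
have {}TE : T = G *m E^T *m E.
  rewrite [LHS]TE; congr (_ *m _); rewrite -mulmxA mulmxBl mul1mx.
  by rewrite -(mulmxA _ A (G *m E^T)) (mulmxA A G) AGE mulmx0 subr0.
have AT : A^T *m invmx H = invmx G *m F.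
  by rewrite AE !trmx_mul trmxK Hsym trmx_inv Gsym -mulmxA mulmxK.
rewrite mulmxA AT -[E^T *m E](mulKmx Gu) (mulmxA G) -TE /T.
by rewrite mulmxBr mulmx1 !mulmxA addrC subrK.
Qed.

End Cometric.

(** Cyclicity of the trace moves both factors [J] from [C] to [B], so the trace equals its
    opposite. *)
Lemma mxtrace_antiinvariant k (J C B : 'M[R]_k) :
  J^T *m C *m J = C -> J *m B *m J^T = - B -> \tr (C *m B) = 0.
Proof.
move=> CJ BJ; have : \tr (C *m B) = - \tr (C *m B).
  rewrite -[in LHS]CJ -!mulmxA mxtrace_mulC -!mulmxA (mulmxA J) BJ.
  by rewrite mulmxN linearN.
lra.
Qed.

Lemma mxtrace_rows m r (E : 'M[R]_(r, m)) (B : 'M[R]_m) :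
  \tr (E^T *m E *m B) = \sum_i (row i E *m B *m (row i E)^T) 0 0.
Proof.
rewrite -mulmxA mxtrace_mulC; apply: eq_bigr => i _.
by rewrite -row_mul mxE [RHS]mxE; apply: eq_bigr => j _; congr (_ * _); rewrite !mxE.
Qed.

End LinearAlgebra.

(** * Second fundamental form of a map *)

Section SecondFundamentalForm.
Context {R : realType}.

Lemma christoffelDl m (G : 'rV[R]_m -> 'M[R]_m) z a u u' v :
  christoffel G z (a *: u + u') v = a *: christoffel G z u v + christoffel G z u' v.
Proof.
apply/rowP => k; rewrite !mxE mulr_sumr -big_split /=; apply: eq_bigr => i _.
rewrite mulr_sumr -big_split /=; apply: eq_bigr => j _.
rewrite mulr_sumr -big_split /=; apply: eq_bigr => l _; rewrite !mxE; ring.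
Qed.

Lemma christoffelDr m (G : 'rV[R]_m -> 'M[R]_m) z u a v v' :
  christoffel G z u (a *: v + v') = a *: christoffel G z u v + christoffel G z u v'.
Proof.
apply/rowP => k; rewrite !mxE mulr_sumr -big_split /=; apply: eq_bigr => i _.
rewrite mulr_sumr -big_split /=; apply: eq_bigr => j _.
rewrite mulr_sumr -big_split /=; apply: eq_bigr => l _; rewrite !mxE; ring.
Qed.

Lemma christoffel0r m (G : 'rV[R]_m -> 'M[R]_m) z u : christoffel G z u 0 = 0.
Proof.
apply/rowP => k; rewrite !mxE big1 // => i _; rewrite big1 // => j _.
by rewrite big1 // => l _; rewrite !mxE mulr0.
Qed.

Lemma christoffelC m (G : 'rV[R]_m -> 'M[R]_m) z u v :
  (\forall y \near z, (G y)^T = G y) ->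
  christoffel G z u v = christoffel G z v u.
Proof.
move=> Gsym; apply/rowP => k; rewrite !mxE exchange_big; apply: eq_bigr => i _.
apply: eq_bigr => j _; apply: eq_bigr => l _.
have -> : 'D_(ebase l) (fun y => G y j i) z = 'D_(ebase l) (fun y => G y i j) z.
  by apply: near_eq_derive; apply: filterS Gsym => y Gy; rewrite -[in LHS]Gy mxE.
ring.
Qed.

Section Map.
Context {m k : nat} (G : 'rV[R]_m -> 'M[R]_m) (H : 'rV[R]_k -> 'M[R]_k)
  (f : 'rV[R]_m -> 'rV[R]_k).

(** The covariant derivative of the differential as a tensor: it involves only the vectors [u] and
    [v], with no extension to fields. *)
Definition second_form (z u v : 'rV[R]_m) : 'rV[R]_k :=
  v *m 'D_u (jacobian f) z
  + christoffel H (f z) (u *m jacobian f z) (v *m jacobian f z)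
  - christoffel G z u v *m jacobian f z.

Lemma second_formE z u (Y : 'rV[R]_m -> 'rV[R]_m) :
  differentiable Y z -> differentiable (jacobian f) z ->
  second_form z u (Y z) =
  nabla_along H f u (fun y => Y y *m jacobian f y) z - nabla G u Y z *m jacobian f z.
Proof.
move=> dY dF; rewrite /nabla_along /nabla /second_form.
rewrite derive_mulmx; [|exact: diff_derivable..].
rewrite mulmxDl opprD; set a := 'D_u Y z *m _; set b := Y z *m _.
set c := christoffel _ _ _ _; set d := christoffel _ _ _ _ *m _.
by rewrite -[a + b + c]addrA [a + (b + c)]addrC -(addrA (b + c)) (addrA a) subrr add0r.
Qed.

Lemma second_formDl z a u u' v : differentiable (jacobian f) z ->
  second_form z (a *: u + u') v = a *: second_form z u v + second_form z u' v.
Proof.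
move=> dF; rewrite /second_form !(deriveE _ dF) linearP.
rewrite christoffelDl !mulmxDl -!scalemxAl christoffelDl mulmxDr -scalemxAr.
by apply/rowP => j; rewrite !mxE; ring.
Qed.

Lemma second_formDr z u a v v' :
  second_form z u (a *: v + v') = a *: second_form z u v + second_form z u v'.
Proof.
rewrite /second_form christoffelDr !mulmxDl -!scalemxAl christoffelDr.
by apply/rowP => j; rewrite !mxE; ring.
Qed.

(** The Christoffel terms are symmetric; the remaining term is, component by component, the Hessian
    of [f], symmetric by [schwarz]. *)
Lemma second_formC z u v :
  (\forall y \near z, (G y)^T = G y) -> (\forall y \near f z, (H y)^T = H y) ->
  (\forall y \near z, differentiable f y) -> differentiable (jacobian f) z ->
  second_form z u v = second_form z v u.
Proof.
move=> Gsym Hsym df dF; rewrite /second_form.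
rewrite (christoffelC u v Gsym) (christoffelC (u *m _) (v *m _) Hsym).
suff -> : v *m 'D_u (jacobian f) z = u *m 'D_v (jacobian f) z by [].
have Djac w : derivable (jacobian f) z w by exact: diff_derivable.
rewrite -(derive_mulmxr v (Djac u)) -(derive_mulmxr u (Djac v)); apply/rowP => j.
have dxF (x : 'rV[R]_m) : differentiable (fun y => x *m jacobian f y) z.
  by apply: differentiable_mulmx => //; exact: differentiable_cst.
have fj x : \forall y \near z, (x *m jacobian f y) 0 j = 'D_x (fun t => f t 0 j) y.
  apply: filterS df => y dfy; rewrite -deriveEjacobian // derive_mxE //.
  exact: diff_derivable.
rewrite !derive_mxE; [|exact: diff_derivable..].
rewrite (near_eq_derive _ (fj u)) (near_eq_derive _ (fj v)).
have dfj x : differentiable (fun y => 'D_x (fun t => f t 0 j) y) z.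
  apply: near_eq_differentiable (fj x) _.
  by have /differentiable_mxP := dxF x; apply.
apply: schwarz => //; apply: filterS df => y dfy.
by move/differentiable_mxP : dfy; apply.
Qed.

Definition second_form_mx (z : 'rV[R]_m) (l : 'I_k) : 'M[R]_m :=
  \matrix_(i, j) second_form z (ebase i) (ebase j) 0 l.

Lemma second_form_mxE z l u v : differentiable (jacobian f) z ->
  second_form z u v 0 l = (u *m second_form_mx z l *m v^T) 0 0.
Proof.
move=> dF; apply: (@bilinear_formE _ _ (fun u v => second_form z u v 0 l)).
  by move=> w a x x'; rewrite second_formDl // !mxE.
by move=> w a x x'; rewrite second_formDr !mxE.
Qed.

Lemma tension_mxtrace z l :
  (\forall y \near z, (G y)^T = G y) -> (\forall y \near f z, (H y)^T = H y) ->
  (\forall y \near z, differentiable f y) -> differentiable (jacobian f) z ->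
  tension G H f z 0 l = \tr (invmx (G z) *m second_form_mx z l).
Proof.
move=> Gsym Hsym df dF; rewrite /tension summxE; apply: eq_bigr => i _.
rewrite summxE mxE; apply: eq_bigr => j _.
rewrite [LHS]mxE [second_form_mx _ _ _ _]mxE; congr (_ * _).
(* The trace of the product pairs [invmx (G z) i j] with the entry at [j], [i], whence the use of
   symmetry. *)
by rewrite second_formC // (second_formE _ (Y := fun=> ebase j)).
Qed.

(** Both sides are computed with the extensions [w *m J (f y) *m A y] and [w *m A y]. The last
    hypothesis, from PHH, matches the terms on the source; PHWC near [z] followed by the parallelism
    of [J] matches those along the map. *)
Lemma second_form_complex (J : 'rV[R]_k -> 'M[R]_k) z x w :
  let A := adjoint G H f in
  differentiable f z -> differentiable (jacobian f) z -> differentiable A z ->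
  differentiable J (f z) ->
  (\forall y \near z,
     A y *m jacobian f y *m J (f y) = J (f y) *m (A y *m jacobian f y)) ->
  (forall X Y, nabla H X (fun y => Y *m J y) (f z) = nabla H X (fun=> Y) (f z) *m J (f z)) ->
  nabla G x (fun y => w *m J (f y) *m A y) z *m jacobian f z
    = nabla G x (fun y => w *m A y) z *m jacobian f z *m J (f z) ->
  second_form z x (w *m J (f z) *m A z) = second_form z x (w *m A z) *m J (f z).
Proof.
move=> A df dF dA dJ phwc par phh.
have dJf : differentiable (fun y => J (f y)) z.
  exact: (@differentiable_comp _ _ _ _ f J).
have dY1 : differentiable (fun y => w *m A y) z.
  by apply: differentiable_mulmx => //; exact: differentiable_cst.
have dY2 : differentiable (fun y => w *m J (f y) *m A y) z.
  apply: differentiable_mulmx => //; apply: differentiable_mulmx => //.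
rewrite (second_formE _ (Y := fun y => w *m A y)) //.
rewrite (second_formE _ (Y := fun y => w *m J (f y) *m A y)) //.
rewrite phh mulmxBl; congr (_ - _).
have dY1F : differentiable (fun y => w *m A y *m jacobian f y) z.
  exact: differentiable_mulmx.
have Y2E : \forall y \near z, w *m J (f y) *m A y *m jacobian f y =
    (w *m A y *m jacobian f y) *m J (f y).
  by apply: filterS phwc => y; rewrite -!mulmxA => <-; rewrite !mulmxA.
rewrite /nabla_along (near_eq_derive _ Y2E) (nbhs_singleton Y2E).
rewrite derive_mulmx; [|exact: diff_derivable..].
rewrite (@derive_comp _ _ _ _ f J) // mulmxDl -addrA.
congr (_ + _); set y1 := w *m A z *m jacobian f z; set X := x *m _.
(* For the constant field [y1], parallelism says exactly that the derivative of [J] is balanced by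
   the two Christoffel terms. *)
have := par X y1; rewrite /nabla derive_mulmxr; last exact: diff_derivable.
by rewrite derive_cst add0r (deriveEjacobian _ df).
Qed.

End Map.
End SecondFundamentalForm.

(** * Fibres of a submersion *)

Lemma derive_constant_along_curve (R : realType) (V W : normedModType R)
    (gamma : R -> V) (v : V) (g : V -> W) c :
  is_derive (0 : R) (1 : R) gamma v -> differentiable g (gamma 0) ->
  (\forall t \near (0 : R), g (gamma t) = c) -> 'D_v g (gamma 0) = 0.
Proof.
move=> [dgamma <-] dg gc.
rewrite -(derive_comp (1 : R) _ dg); last exact/derivable1_diffP.
rewrite (@near_eq_derive _ _ _ _ (cst c)) ?derive_cst //.
Qed.

Lemma cimg_param (R : realType) (d : nat) (P : manifold R d) (c : chart P) z :
  cimg c z -> dom c (param c z) /\ Defs.coord c (param c z) = z.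
Proof. by move=> [p pc <-]; rewrite coordK. Qed.

Lemma gram_near_sym (R : realType) (d : nat) (P : manifold R d)
    (q : riemannian_metric P) (c : chart P) y :
  cimg c y -> \forall x \near y, (gram q c x)^T = gram q c x.
Proof. by move=> yc; apply: open_near (@coord_open _ _ _ c) yc _ => x; exact: gram_sym. Qed.

Lemma gram_unitmx (R : realType) (d : nat) (P : manifold R d)
    (q : riemannian_metric P) (c : chart P) y :
  cimg c y -> gram q c y \in unitmx.
Proof. by move=> yc; apply: posdef_unitmx => v; exact: gram_pos. Qed.

(** * Submersions read in charts *)

Section Submersions.
Context {R : realType} {m k : nat} (M : manifold R m) (N : manifold R k)
  (phi : M -> N)
  (phi_submersion : submersion phi).
Implicit Types (a : chart M) (b : chart N).

Lemma local_domP a b z :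
  local_dom phi a b z <-> cimg a z /\ dom b (phi (param a z)).
Proof.
split=> [[p [pa pb] <-]|[za zb]]; first by rewrite coordK //; split => //; exists p.
by have [pa pz] := cimg_param za; exists (param a z).
Qed.

Lemma local_map_cimg a b z : local_dom phi a b z -> cimg b (local_map phi a b z).
Proof. by move=> /local_domP [_ zb]; exists (phi (param a z)). Qed.

Lemma local_dom_cimg a b : local_dom phi a b `<=` cimg a.
Proof. by move=> z /local_domP []. Qed.

Lemma local_dom_open a b : open (local_dom phi a b).
Proof.
rewrite openE => z zab; have /local_domP [za zb] := zab.
have cz : {for z, continuous (phi \o param a)}.
  apply: continuous_comp; first exact: param_continuous.
  by have [[cphi _] _] := phi_submersion; exact: cphi.
have n1 : \forall y \near z, dom b (phi (param a y)).
  by apply: cz; apply: open_nbhs_nbhs; split => //; exact: dom_open.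
have n2 : \forall y \near z, cimg a y.
  by apply: open_nbhs_nbhs; split => //; exact: coord_open.
rewrite /interior; near=> y; apply/local_domP; split; near: y; [exact: n2|exact: n1].
Unshelve. all: by end_near. Qed.

Section AtPoint.
Context {a : chart M} {b : chart N} {z : 'rV[R]_m} (zab : local_dom phi a b z).
Local Notation f := (local_map phi a b).

Lemma local_map_differentiable : differentiable f z.
Proof. by have [[_ sf] _] := phi_submersion; exact: smooth_on_differentiable (sf a b) zab. Qed.

Lemma local_map_near_differentiable : \forall y \near z, differentiable f y.
Proof.
have [[_ sf] _] := phi_submersion.
apply: (open_near (@local_dom_open a b) zab) => y.
exact: (smooth_on_differentiable (sf a b)).
Qed.

Lemma smooth_on_local_jacobian : smooth_on (local_dom phi a b) (jacobian f).
Proof.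
by have [[_ sf] _] := phi_submersion; apply: smooth_on_jacobian => //; exact: local_dom_open.
Qed.

Lemma local_jacobian_differentiable : differentiable (jacobian f) z.
Proof. exact: smooth_on_differentiable smooth_on_local_jacobian zab. Qed.

End AtPoint.
End Submersions.

(** * The adjoint differential and the tangent spaces of the fibres *)

Section Adjoint.
Context {R : realType} {m k : nat} {M : manifold R m} {N : manifold R k}
  (g : riemannian_metric M) (h : riemannian_metric N) {phi : M -> N}
  (phi_submersion : submersion phi)
  {a : chart M} {b : chart N} {z : 'rV[R]_m} (zab : local_dom phi a b z).
Local Notation f := (local_map phi a b).
Local Notation F := (jacobian (local_map phi a b) z).
Local Notation A := (adjoint (gram g a) (gram h b) (local_map phi a b) z).

Lemma adjoint_differentiable :
  differentiable (adjoint (gram g a) (gram h b) f) z.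
Proof.
have df := local_map_differentiable phi_submersion zab.
apply: differentiable_mulmx; first apply: differentiable_mulmx.
- apply: (@differentiable_comp _ _ _ _ f (gram h b)) => //.
  apply: (smooth_on_differentiable (@gram_smooth _ _ _ h b) (local_map_cimg zab)).
- by apply: differentiable_trmx; exact: local_jacobian_differentiable.
- apply: differentiable_invmx; last by apply: gram_unitmx; exact: local_dom_cimg zab.
  apply: (smooth_on_differentiable (@gram_smooth _ _ _ g a) (local_dom_cimg zab)).
Qed.

Lemma adjoint_jacobian_unit : A *m F \in unitmx.
Proof.
apply: horizontal_gram_unit (erefl A) _ _ _ _.
- exact: gram_sym (local_dom_cimg zab).
- exact: gram_pos (local_dom_cimg zab).
- exact: gram_unitmx (local_map_cimg zab).
- by have [_] := phi_submersion; apply.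
Qed.

(** A curve in the fibre has constant image in the chart [b], so its velocity is killed by the
    differential. Conversely [level_set_curve] applies with the horizontal right inverse
    [invmx (A *m F) *m A]. *)
Lemma fibre_tangentP y v : phi (param a z) = y ->
  tangent (phi @^-1` [set y]) a z v <-> v *m F = 0.
Proof.
move=> zy; have df := local_map_differentiable phi_submersion zab.
split=> [[gamma [g0 gK dgamma]]|vF].
  rewrite -deriveEjacobian // -g0.
  apply: (derive_constant_along_curve (c := Defs.coord b y) dgamma); first by rewrite g0.
  by apply: filterS gK => t [_ /= ty]; rewrite /local_map /= ty.
pose P := invmx (A *m F) *m A.
have PF : P *m F = 1%:M by rewrite -mulmxA mulVmx // adjoint_jacobian_unit.
have dF := local_jacobian_differentiable phi_submersion zab.
have [gamma [g0 gf dgamma]] := level_set_curve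
  (local_map_near_differentiable phi_submersion zab)
  (differentiable_continuous dF) PF vF.
exists gamma; split => //.
have cg : gamma t @[t --> (0 : R)] --> z.
  rewrite -g0; apply: differentiable_continuous; apply/derivable1_diffP.
  by have [] := dgamma.
have gd : \forall t \near (0 : R), local_dom phi a b (gamma t).
  apply: cg; apply: open_nbhs_nbhs; split => //.
  exact: (local_dom_open phi_submersion).
apply: filterS2 gf gd => t ft /local_domP [ta tb]; split => //=.
have /local_domP [za zb] := zab.
(* Equality of coordinates gives equality of points only because both lie in [dom b]. *)
by rewrite -zy -(coordK tb) -(coordK zb); congr (param b _).
Qed.

End Adjoint.

(** * The second fundamental form of the fibres *)

Section Fibres.
Context {R : realType} {m k : nat} {M : manifold R m} {N : manifold R k}
  (g : riemannian_metric M) (h : riemannian_metric N) {phi : M -> N}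
  (phi_submersion : submersion phi)
  {a : chart M} {b : chart N} {z : 'rV[R]_m} (zab : local_dom phi a b z).
Local Notation f := (local_map phi a b).
Local Notation F := (jacobian (local_map phi a b) z).
Local Notation A := (adjoint (gram g a) (gram h b) (local_map phi a b) z).

(** The image of [W] under the differential vanishes along the fibre, hence so does its derivative
    along a curve in the fibre with velocity [e]. What is left of the second form is minus the image
    of the covariant derivative of [W], which sees only its normal part [s]. *)
Lemma fibre_second_fundamental_form y e s : phi (param a z) = y ->
  tangent (phi @^-1` [set y]) a z e ->
  second_fundamental_form g (phi @^-1` [set y]) a z e e s ->
  s *m F = - second_form (gram g a) (gram h b) f z e e.
Proof.
move=> zy te [U [W [[oU Uz Ua sW] tW We _ tn]]].
have dW := smooth_on_differentiable sW Uz.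
have dF := local_jacobian_differentiable phi_submersion zab.
have eF : e *m F = 0 by apply/(fibre_tangentP g h phi_submersion zab _ zy).
have [gamma [g0 gK dgamma]] := te.
have cg : gamma t @[t --> (0 : R)] --> z.
  rewrite -g0; apply: differentiable_continuous; apply/derivable1_diffP.
  by have [] := dgamma.
have gU : \forall t \near (0 : R), U (gamma t).
  by apply: cg; exact: open_nbhs_nbhs.
have gd : \forall t \near (0 : R), local_dom phi a b (gamma t).
  apply: cg; apply: open_nbhs_nbhs; split => //.
  exact: (local_dom_open phi_submersion).
have DWF : 'D_e (fun x => W x *m jacobian f x) z = 0.
  rewrite -g0; apply: (derive_constant_along_curve (c := 0) dgamma).
    by rewrite g0; exact: differentiable_mulmx.
  near=> t; have [_ /= ty] : cimg a (gamma t) /\ (phi @^-1` [set y]) (param a (gamma t)).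
    by near: t.
  have td : local_dom phi a b (gamma t) by near: t.
  apply/(fibre_tangentP g h phi_submersion td _ ty); apply: tW => //.
  by near: t.
have := (fibre_tangentP g h phi_submersion zab _ zy).1 tn.
rewrite mulmxBl => /eqP; rewrite subr_eq0 => /eqP <-.
rewrite -{3}We (second_formE _ _ _ (Y := W)) // /nabla_along DWF We eF christoffel0r.
by rewrite addr0 sub0r opprK.
Unshelve. all: by end_near. Qed.

(* The extension [W] of [e] is [e - e F (Q F)^-1 Q] for the fixed matrix
   [Q = A], multiplied by [\det (Q F)], normalized at [z], to stay polynomial
   in the entries of the Jacobian. *)
Lemma fibre_second_fundamental_form_exists y e : phi (param a z) = y ->
  e *m F = 0 ->
  exists s, second_fundamental_form g (phi @^-1` [set y]) a z e e s.
Proof.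
move=> zy eF; have Su := adjoint_jacobian_unit g h phi_submersion zab.
set Q := A in Su; pose S x := Q *m jacobian f x.
have d0 : \det (S z) != 0 by rewrite -unitfE -unitmxE.
pose W x := (\det (S z))^-1 *: (\det (S x) *: e
  + - 1 *: (e *m jacobian f x *m \adj (S x) *m Q)).
have oU := @local_dom_open _ _ _ _ _ _ phi_submersion a b.
have sF := smooth_on_local_jacobian phi_submersion (a := a) (b := b).
have sS : smooth_on (local_dom phi a b) S.
  by apply: smooth_on_mulmx => //; exact: smooth_on_cstmx.
have sW : smooth_on (local_dom phi a b) W.
  apply: smooth_onZmx => //; first exact: smooth_on_cst.
  apply: smooth_onDmx => //.
    by apply: smooth_onZmx => //; [exact: smooth_on_det|exact: smooth_on_cstmx].
  apply: smooth_onZmx => //; first exact: smooth_on_cst.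
  apply: smooth_on_mulmx => //; last exact: smooth_on_cstmx.
  apply: smooth_on_mulmx => //; last exact: smooth_on_adj.
  by apply: smooth_on_mulmx => //; exact: smooth_on_cstmx.
have WF x : W x *m jacobian f x = 0.
  rewrite /W -scalemxAl mulmxDl -!scalemxAl -(mulmxA _ Q) -/(S x).
  rewrite -(mulmxA _ (\adj (S x))) mul_adj_mx mul_mx_scalar scaleN1r subrr scaler0 //.
have We : W z = e.
  by rewrite /W eF !mul0mx scaler0 addr0 scalerA mulVf // scale1r.
pose n := nabla (gram g a) e W z.
(* The witness is the horizontal projection of [n]: a combination of rows of the adjoint, with the
   same image as [n] under [F]. *)
exists (n *m F *m invmx (S z) *m Q), (local_dom phi a b), W; split => //.
- by split => //; exact: local_dom_cimg.
- by move=> x xU /= Kx; apply/(fibre_tangentP g h phi_submersion xU (W x) Kx); exact: WF.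
- move=> u /(fibre_tangentP g h phi_submersion zab _ zy) uF.
  rewrite adjointP ?uF /inner ?trmx0 ?mulmx0 ?mxE //.
  by apply: gram_unitmx; exact: local_dom_cimg zab.
- apply/(fibre_tangentP g h phi_submersion zab _ zy).
  by rewrite mulmxBl -(mulmxA _ Q) -/(S z) mulmxKV // subrr.
Qed.

End Fibres.

(** * Tension field of a PHH submersion *)

Section Harmonicity.
Context {R : realType} {m k : nat} {M : manifold R m} {N : manifold R k}
  (g : riemannian_metric M) (h : riemannian_metric N)
  (J : almost_complex_structure N) (hJ : kahler h J) {phi : M -> N}
  (phi_submersion : submersion phi) (phi_PHH : PHH g h J phi)
  {a : chart M} {b : chart N} {z : 'rV[R]_m} (zab : local_dom phi a b z).
Local Notation f := (local_map phi a b).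
Local Notation F := (jacobian (local_map phi a b) z).
Local Notation A := (adjoint (gram g a) (gram h b) (local_map phi a b) z).
Local Notation Jz := (jmx J b (local_map phi a b z)).
Local Notation B := (second_form (gram g a) (gram h b) (local_map phi a b) z).

Lemma second_form_symmetric u v : B u v = B v u.
Proof.
apply: second_formC.
- by apply: gram_near_sym; exact: local_dom_cimg zab.
- by apply: gram_near_sym; exact: local_map_cimg zab.
- exact: local_map_near_differentiable zab.
- exact: local_jacobian_differentiable zab.
Qed.

(* The horizontal vector [x A] is extended by the horizontal field
   [x H F^T G^-1], with [H] frozen at [z] and [G^-1] replaced by [\adj G] to
   stay polynomial in smooth functions. *)
Lemma second_form_horizontal_complex x w :
  B (x *m A) (w *m Jz *m A) = B (x *m A) (w *m A) *m Jz.
Proof.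
have [_ par] := hJ; have [phwc phh] := phi_PHH.
have df := local_map_differentiable phi_submersion zab.
have dF := local_jacobian_differentiable phi_submersion zab.
have dA := adjoint_differentiable g h phi_submersion zab.
have fz := local_map_cimg zab.
have oU := @local_dom_open _ _ _ _ _ _ phi_submersion a b.
have oW : open (cimg b) by exact: coord_open.
have Gu y : local_dom phi a b y -> gram g a y \in unitmx.
  by move=> yab; apply: gram_unitmx; exact: local_dom_cimg yab.
apply: (second_form_complex (J := jmx J b)) => //.
- exact: (smooth_on_differentiable (@jmx_smooth _ _ _ J b) fz).
- by apply: (open_near oU zab) => y yab; exact: phwc.
- move=> X Y; apply: (par b (cimg b) (fun=> X) (fun=> Y)) => //.
    exact: smooth_on_cstmx.
  exact: smooth_on_cstmx.
pose d := \det (gram g a z).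
have d0 : d != 0 by rewrite -unitfE -unitmxE Gu.
pose X y := d^-1 *: (x *m gram h b (f z) *m (jacobian f y)^T *m \adj (gram g a y)).
have sF := smooth_on_local_jacobian phi_submersion (a := a) (b := b).
have sG : smooth_on (local_dom phi a b) (gram g a).
  by move=> s y yab; apply: gram_smooth; exact: local_dom_cimg yab.
have sX : smooth_on (local_dom phi a b) X.
  apply: smooth_onZmx => //; first exact: smooth_on_cst.
  apply: smooth_on_mulmx => //; last exact: smooth_on_adj.
  apply: smooth_on_mulmx => //; last exact: smooth_on_trmx.
  exact: smooth_on_cstmx.
have hX y : local_dom phi a b y -> horizontal (gram g a) f y (X y).
  move=> yab v vF; rewrite /inner /X -!scalemxAl -(mulmxA _ (\adj _)).
  rewrite mul_adj_mx mul_mx_scalar -scalemxAl -(mulmxA _ _ v^T) -trmx_mul vF.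
  by rewrite trmx0 mulmx0 !scaler0 mxE.
have Xz : X z = x *m A.
  rewrite /X /adjoint /invmx Gu // !mulmxA.
  by rewrite -scalemxAr.
(* PHH is applied to the constant field [w] on the chart image in [N]. *)
have := phh a b (local_dom phi a b) X (cimg b) (fun=> w) oU (fun y yab => yab)
  sX hX oW (fun y yb => yb) (smooth_on_cstmx _ oW) z zab fz.
by rewrite Xz.
Qed.

Lemma hermitian_mx : Jz *m gram h b (f z) *m Jz^T = gram h b (f z).
Proof.
have [herm _] := hJ; apply: mx_form_inj => u v.
have := herm b _ (local_map_cimg zab) u v; rewrite /inner trmx_mul.
by rewrite !mulmxA.
Qed.

(* The horizontal part of the trace cancels: the metric induced on the
   horizontal space is invariant under [J], which changes the sign of [B]. *)
Lemma tension_vertical r (E : 'M[R]_(r, m)) :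
  E *m F = 0 -> E *m gram g a z *m E^T = 1%:M ->
  (forall v : 'rV_m, v *m F = 0 -> v = v *m gram g a z *m E^T *m E) ->
  tension (gram g a) (gram h b) f z = \sum_i B (row i E) (row i E).
Proof.
move=> EF EG Efull; apply/rowP => l.
have za := local_dom_cimg zab; have fz := local_map_cimg zab.
have dF := local_jacobian_differentiable phi_submersion zab.
have Gsym := gram_sym g za; have Hsym := gram_sym h fz.
have Gu := gram_unitmx g za; have Hu := gram_unitmx h fz.
have Su := adjoint_jacobian_unit g h phi_submersion zab.
have JJ := jmx_sq J fz.
rewrite tension_mxtrace //; last exact: local_map_near_differentiable zab;
  last (by apply: gram_near_sym); last by apply: gram_near_sym.
rewrite (cometric_split (erefl A) Gsym Hsym Gu Hu Su EF EG Efull).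
set Bl := second_form_mx _ _ _ _ _.
rewrite mulmxDl linearD /= mxtrace_rows summxE.
under [in RHS]eq_bigr do rewrite second_form_mxE //.
suff -> : \tr (A^T *m (invmx (gram h b (f z)) *m invmx (A *m F)) *m A *m Bl) = 0.
  by rewrite add0r.
(* Cyclicity brings the trace to the target: the induced inverse metric times the matrix of [B] on
   the pulled-back vectors. *)
rewrite -(mulmxA _ A Bl) -(mulmxA A^T) mxtrace_mulC -(mulmxA (invmx (gram h b (f z)) *m _)).
have phwc : A *m F *m Jz = Jz *m (A *m F) by case: phi_PHH => + _; apply.
apply: (@mxtrace_antiinvariant _ _ Jz).
  (* Invariance under [Jz]: PHWC makes [invmx (A *m F)] commute with it, and the Hermitian condition
     makes the inverse of [h] invariant. *)
  have cS : invmx (A *m F) *m Jz = Jz *m invmx (A *m F).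
    by apply: (can_inj (mulKmx Su)); rewrite mulKVmx // mulmxA phwc mulmxK.
  have HJ : gram h b (f z) *m Jz^T = - (Jz *m gram h b (f z)).
    by rewrite -[in RHS]hermitian_mx !mulmxA JJ !mulNmx mul1mx opprK.
  have cH : Jz^T *m invmx (gram h b (f z)) *m Jz = invmx (gram h b (f z)).
    apply: (can_inj (mulKmx Hu)); rewrite mulmxV // !mulmxA HJ !mulNmx.
    by rewrite mulmxK // JJ opprK.
  by rewrite -(mulmxA Jz^T) -(mulmxA _ _ Jz) cS (mulmxA _ Jz) mulmxA (mulmxA Jz^T) cH.
apply: mx_form_inj => u w.
have BE x y : B (x *m A) (y *m A) 0 l = (x *m A *m Bl *m (y *m A)^T) 0 0.
  exact: second_form_mxE.
(* Complex linearity in the second argument, used twice through the symmetry of [B], produces the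
   square of [Jz]. *)
have BJ : B (u *m Jz *m A) (w *m Jz *m A) = - B (u *m A) (w *m A).
  rewrite second_form_horizontal_complex second_form_symmetric.
  rewrite second_form_horizontal_complex -mulmxA JJ mulmxN mulmx1.
  by rewrite second_form_symmetric.
have -> : u *m (Jz *m (A *m Bl *m A^T) *m Jz^T) *m w^T =
    u *m Jz *m A *m Bl *m (w *m Jz *m A)^T by rewrite !trmx_mul !mulmxA.
rewrite -BE BJ mxE BE mulmxN mulNmx [RHS]mxE.
by rewrite trmx_mul !mulmxA.
Qed.

End Harmonicity.

Theorem theorem3p6 (R : realType) (m n : nat) (hn : (2 <= n)%N)
    (M : manifold R m) (g : riemannian_metric M)
    (N : manifold R (2 * n)) (h : riemannian_metric N)
    (J : almost_complex_structure N) (hJ : kahler h J)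
    (V : vector_field M) (phi : M -> N)
    (phi_submersion : submersion phi) (phi_PHH : PHH g h J phi) :
  V_harmonic g h V phi <->
  (forall y : N, V_minimal g V (phi @^-1` [set y])%classic).
Proof.
split=> [harm y c z zc /= zy r e s [te eg efull] se|vmin a b z zab].
  have [b yb] := dom_cover (phi (param c z)).
  have zcb : local_dom phi c b z by apply/local_domP.
  have te0 j := (fibre_tangentP g h phi_submersion zcb (e j) zy).1 (te j).
  pose E : 'M[R]_(r, m) := \matrix_j e j.
  have EF : E *m jacobian (local_map phi c b) z = 0.
    by apply/row_matrixP => j; rewrite row_mul rowK te0 row0.
  have EG : E *m gram g c z *m E^T = 1%:M.
    by apply/matrixP => i j; rewrite gram_rows !rowK eg mxE.
  have Efull (v : 'rV_m) : v *m jacobian (local_map phi c b) z = 0 ->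
      v = v *m gram g c z *m E^T *m E.
    move=> /(fibre_tangentP g h phi_submersion zcb v zy) /efull [x ->].
    have -> : \sum_j x j *: e j = (\row_j x j) *m E.
      by rewrite mulmx_sum_row; apply: eq_bigr => j _; rewrite rowK mxE.
    by set X := \row_j x j; rewrite -(mulmxA X E) -(mulmxA X (E *m _)) EG mulmx1.
  apply/(fibre_tangentP g h phi_submersion zcb _ zy).
  have := harm c b z zcb.
  rewrite (tension_vertical hJ phi_submersion phi_PHH zcb EF EG Efull) => /eqP.
  (* Harmonicity makes the image of [V] minus the sum of the [B] terms; the images of the normal
     parts [s j] are the opposites of the same terms, so everything cancels. *)
  rewrite addrC addr_eq0 => /eqP VF; rewrite mulmxBl VF opprK mulmx_suml -big_split.
  apply: big1 => j _ /=.
  rewrite (fibre_second_fundamental_form h phi_submersion zcb zy (te j) (se j)).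
  by rewrite rowK addNr.
have za := local_dom_cimg zab.
(* [V_minimal] quantifies over orthonormal bases and values of the second fundamental form, so
   existence of both must be supplied before it yields information. *)
have [r [E [EF EG Efull]]] := orthonormal_kernel
  (jacobian (local_map phi a b) z) (gram_sym g za) (gram_pos g za).
rewrite (tension_vertical hJ phi_submersion phi_PHH zab EF EG Efull).
pose y := phi (param a z).
have eF j : row j E *m jacobian (local_map phi a b) z = 0.
  by rewrite -row_mul EF row0.
have te j : tangent (phi @^-1` [set y]) a z (row j E).
  exact/(fibre_tangentP g h phi_submersion zab _ (erefl y)).
pose s j := projT1 (cid (fibre_second_fundamental_form_exists g h
  phi_submersion zab (erefl y) (eF j))).
have se j : second_fundamental_form g (phi @^-1` [set y]) a z (row j E) (row j E) (s j).
  exact: projT2 (cid _).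
have ob : orthonormal_basis g (phi @^-1` [set y]) a z (fun j => row j E).
  split => //.
    by move=> i j; rewrite -gram_rows EG mxE.
  move=> v /(fibre_tangentP g h phi_submersion zab _ (erefl y)) /Efull ->.
  by exists (fun j => (v *m gram g a z *m E^T) 0 j); rewrite mulmx_sum_row.
have := vmin y a z za erefl r (fun j => row j E) s ob se.
move=> /(fibre_tangentP g h phi_submersion zab _ (erefl y)).
rewrite mulmxBl => /eqP; rewrite subr_eq0 => /eqP <-.
rewrite mulmx_suml -big_split; apply: big1 => j _ /=.
rewrite (fibre_second_fundamental_form h phi_submersion zab (erefl y) (te j) (se j)).
by rewrite subrr.
Qed.
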